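(* Let $f\in X'$, $\nu>0$, $\hat\nu>0$, $\mu>0$, $H>0$. Let $u\in V$ be a weak solution of the steady Navier-Stokes equations with viscosity $\nu$ and forcing $f$, and let $v\in V$ solve the CDA-NSE system $$\hat \nu(\nabla v,\nabla \chi) + b(v,v,\chi) + \mu(I_H (v-u),I_H \chi)=\langle f,\chi \rangle\qquad \forall \chi\in V.$$ Set $C_v := \left( \hat \nu^{-2} + \mu C_P^2 C_I^2 \nu^{-2}\hat \nu^{-1} \right)^{1/2} \| f \|_{-1}$ and $\alpha_0=M\nu^{-2}\|f\|_{-1}$. Assume $$H \leq \frac{\sqrt{2}\,\hat{\nu}^2}{\sqrt{27}\, C_I M^2 C_v^2},\qquad \mu\ge \frac{\hat \nu}{2C_I^2 H^2},\qquad H<\left(46\,C_I\, \nu^{3/2}\, \hat \nu^{-3/2} \alpha_0^2 \right)^{-1}.$$ Then $$\frac{\| \nabla (u-v)\|}{\|\nabla u\|} \le 2\sqrt 2\, \frac{| \hat \nu- \nu|}{ \hat \nu}\quad(\text{the quotient being understood for } \nabla u\neq 0),$$ $$\| u-v \| \le \sqrt{2}\, C_I H\, \frac{|\hat \nu- \nu|}{\hat\nu\, \nu}\, \|f\|_{-1}.$$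
   Context: $\Omega\subset\mathbb{R}^d$, $d\in\{2,3\}$, is open, connected and bounded, with either a $C^2$ boundary or being a convex polygon/polyhedron. $(\cdot,\cdot)$ and $\|\cdot\|$ are the $L^2(\Omega)$ inner product and norm. $X=(H_0^1(\Omega))^d$ with norm $\|\nabla\cdot\|$, $V=\{v\in X:\ \nabla\cdot v=0\}$, $X'$ is the dual of $X$ with dual norm $\|\cdot\|_{-1}$ and pairing $\langle\cdot,\cdot\rangle$. $C_P$ is the Poincaré constant: $\|\phi\|\le C_P\|\nabla\phi\|$ for all $\phi\in X$. Trilinear form: $b(u,v,w)=(u\cdot\nabla v,w)$. $M$ is a constant depending only on $\Omega$ such that for all $u,v,w\in X$: $b(u,v,w)\le M\|u\|^{1/2}\|\nabla u\|^{1/2}\|\nabla v\|\|\nabla w\|$, $b(u,v,w)\le M\|\nabla u\|\|\nabla v\|\|\nabla w\|$, and $b(u,v,w)\le M\|\nabla u\|\|\nabla v\|\|w\|^{1/2}\|\nabla w\|^{1/2}$. Weak solution $u$ of the steady Navier-Stokes equations with viscosity $\nu$ and forcing $f$ (no-slip boundary conditions): $u\in V$ with $\nu(\nabla u,\nabla\chi)+b(u,u,\chi)=\langle f,\chi\rangle$ for all $\chi\in V$. Such $u$ satisfies $\|\nabla u\|\le\nu^{-1}\|f\|_{-1}$. $I_H$ is a linear interpolation operator with characteristic point spacing $H>0$ and constant $C_I>0$ such that for all $\phi\in X$: $\|I_H\phi\|\le C_I\|\phi\|$ and $\|\phi-I_H\phi\|\le C_I H\|\nabla\phi\|$. Standing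 bound for $I_H$: for all $\phi\in X$, $\frac{\hat\nu}{2}\|\nabla\phi\|^2+\lambda\|\phi\|^2\le\hat\nu\|\nabla\phi\|^2+\mu\|I_H\phi\|^2$, where $\lambda=\min\{\mu,\frac{\hat\nu}{2C_I^2H^2}\}$. *)

(* Defs.v *)
From HB Require Import structures.
From mathcomp Require Import all_boot all_order all_algebra.
From mathcomp Require Import all_classical all_reals all_analysis.

Set Implicit Arguments.
Unset Strict Implicit.
Unset Printing Implicit Defensive.

Import Order.TTheory GRing.Theory Num.Theory.
Import numFieldNormedType.Exports.

Local Open Scope classical_set_scope.
Local Open Scope ring_scope.

Definition row_display : measure_display.
Proof. exact. Qed.

(* The sigma-algebra on R^n generated by the coordinates, i.e. the Borel
   sigma-algebra. *)
Section measurable_row.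
Context {R : realType} (n : nat).

Let coors : 'I_n -> 'rV[R]_n -> R := fun i x => x 0 i.

Let row_set0 : g_sigma_preimage coors set0.
Proof. exact: sigma_algebra0. Qed.

Let row_setC A : g_sigma_preimage coors A -> g_sigma_preimage coors (~` A).
Proof. exact: sigma_algebraC. Qed.

Let row_bigcup (F : (set 'rV[R]_n)^nat) :
  (forall i, g_sigma_preimage coors (F i)) ->
  g_sigma_preimage coors (\bigcup_i (F i)).
Proof. exact: sigma_algebra_bigcup. Qed.

HB.instance Definition _ := @isMeasurable.Build row_display
  'rV[R]_n (g_sigma_preimage coors) row_set0 row_setC row_bigcup.

End measurable_row.

Section lebesgue_row.
Context {R : realType}.

Lemma measurable_coord n (i : 'I_n) :
  measurable_fun [set: 'rV[R]_n] (fun x : 'rV[R]_n => x 0 i).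
Proof.
move=> _ Y mY; rewrite setTI; apply: sub_sigma_algebra => /=.
rewrite -bigcup_seq/=; exists i => /=; first by rewrite mem_index_enum.
by exists Y => //; rewrite setTI.
Qed.

Lemma measurable_fun_rowP d (T : measurableType d) n (f : T -> 'rV[R]_n) :
  (forall i, measurable_fun [set: T] (fun x => f x 0 i)) ->
  measurable_fun [set: T] f.
Proof.
move=> mf _ A mA; rewrite setTI.
suff : g_sigma_preimage (fun i (x : T) => f x 0 i) `<=` measurable.
  apply; rewrite (g_sigma_preimage_comp (fun i (x : 'rV[R]_n) => x 0 i)).
  by exists A => //; rewrite setTI.
apply: smallest_sub; first exact: sigma_algebra_measurable.
rewrite -bigcup_seq; apply: bigcup_sub => i _.
by move=> _ [B mB <-]; exact: mf.
Qed.

Definition row_cons n (z : measurableTypeR R * 'rV[R]_n) : 'rV[R]_n.+1 :=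
  row_mx ((z.1 : R)%:M : 'rV[R]_1) z.2.

Definition row_uncons n (x : 'rV[R]_n.+1) :
    measurableTypeR R * 'rV[R]_n :=
  (x 0 0, @rsubmx R 1 1 n x).

Lemma row_consK n : cancel (@row_cons n) (@row_uncons n).
Proof.
case=> a t; rewrite /row_uncons /row_cons /= row_mxKr; congr pair.
by rewrite mxE; case: splitP => [j _|//]; rewrite ord1 mxE.
Qed.

Lemma measurable_row_cons n :
  measurable_fun [set: (measurableTypeR R * 'rV[R]_n)%type] (@row_cons n).
Proof.
apply: measurable_fun_rowP => i; rewrite /row_cons.
case: (@split_ordP 1 n i) => j ->.
- rewrite (_ : (fun _ => _) = fst); first exact: measurable_fst.
  by apply/funext => z; apply: (etrans (row_mxEl _ _ _ _)); rewrite ord1 mxE.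
- rewrite (_ : (fun _ => _) = (fun x : 'rV[R]_n => x 0 j) \o snd).
    by apply: measurableT_comp; [exact: measurable_coord|exact: measurable_snd].
  by apply/funext => z; exact: (etrans (row_mxEr _ _ _ _)).
Qed.

Lemma measurable_row_uncons n :
  measurable_fun [set: 'rV[R]_n.+1] (@row_uncons n).
Proof.
apply/measurable_fun_pairP; split; first exact: measurable_coord.
apply: measurable_fun_rowP => i /=.
rewrite (_ : (fun _ => _) = (fun x : 'rV[R]_n.+1 => x 0 (rshift 1 i))).
  exact: measurable_coord.
by apply/funext => x /=; rewrite mxE.
Qed.

End lebesgue_row.

(* Image of lambda x mu under (a, t) |-> (a, t_0, ..., t_(n-1)). *)
Section lebesgue_step.
Context {R : realType} (n : nat).
Variable mu : {sigma_finite_measure set 'rV[R]_n -> \bar R}.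

Let lam : {sigma_finite_measure set (measurableTypeR R) -> \bar R} :=
  @lebesgue_measure R.

Let prd : {measure set (measurableTypeR R * 'rV[R]_n)%type -> \bar R} :=
  product_measure1 lam mu.

Definition lebesgue_step : set 'rV[R]_n.+1 -> \bar R :=
  pushforward prd (@row_cons R n).

Let step0 : lebesgue_step set0 = 0%E.
Proof. by rewrite /lebesgue_step /pushforward preimage_set0 (measure0 prd). Qed.

Let step_ge0 A : (0 <= lebesgue_step A)%E.
Proof. exact: (measure_ge0 prd). Qed.

Let step_sigma_additive : semi_sigma_additive lebesgue_step.
Proof.
move=> F mF tF mUF; rewrite /lebesgue_step /pushforward preimage_bigcup.
have mp A : measurable A -> measurable (@row_cons R n @^-1` A).
  by move=> mA; rewrite -[X in measurable X]setTI; exact: measurable_row_cons.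
apply: (@measure_semi_sigma_additive _ _ _ prd).
- by move=> k; apply: mp; exact: mF.
- by move=> i j _ _ [z [/= Fi Fj]]; apply: (tF i j) => //; exists (row_cons z).
- by rewrite -preimage_bigcup; exact: mp.
Qed.

HB.instance Definition _ := isMeasure.Build _ _ _ lebesgue_step
  step0 step_ge0 step_sigma_additive.

Let step_sigma_finite : sigma_finite setT lebesgue_step.
Proof.
have /sigma_finiteP[F' [FT' ndF mF']] := sigma_finiteT lam.
have /sigma_finiteP[G [GT ndG mG]] := sigma_finiteT mu.
exists (fun k => @row_uncons R n @^-1` (F' k `*` G k)).
  rewrite -preimage_bigcup -(preimage_setT (@row_uncons R n)); congr preimage.
  rewrite predeqE => -[x y]; split=> // _.
  have [i _ Fx] : (\bigcup_i F' i) x by rewrite -FT'.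
  have [j _ Gy] : (\bigcup_i G i) y by rewrite -GT.
  exists (maxn i j) => //; split=> /=.
  - by move: x Fx; exact/subsetPset/ndF/leq_maxl.
  - by move: y Gy; exact/subsetPset/ndG/leq_maxr.
move=> k; have [mFk Foo] := mF' k; have [mGk Goo] := mG k; split.
  rewrite -[X in measurable X]setTI; apply: measurable_row_uncons => //.
  exact: measurableX.
rewrite /lebesgue_step /pushforward -comp_preimage.
rewrite (_ : _ \o _ = id); last by apply/funext => z /=; rewrite row_consK.
rewrite preimage_id [X in (X < _)%E](@product_measure1E _ _ _ _ _ lam mu)//.
by rewrite lte_mul_pinfty// ge0_fin_numE.
Qed.

HB.instance Definition _ := Measure_isSigmaFinite.Build _ _ _ lebesgue_step
  step_sigma_finite.

End lebesgue_step.

(* The n-dimensional Lebesgue measure; R^0 is a point, of measure 1. *)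
Fixpoint leb {R : realType} n : {sigma_finite_measure set 'rV[R]_n -> \bar R} :=
  match n with
  | 0 => \d_ (0 : 'rV[R]_0)
  | m.+1 => lebesgue_step (leb m)
  end.

Section smooth_functions.
Context {R : realType} (n : nat).
Implicit Types f : 'rV[R]_n -> R.

Definition partial (i : 'I_n) f : 'rV[R]_n -> R := 'D_(delta_mx 0 i) f.

Definition partials (s : seq 'I_n) f : 'rV[R]_n -> R := foldr partial f s.

Definition Ck k f : Prop := forall s, (size s <= k)%N ->
  continuous (partials s f) /\
  ((size s < k)%N ->
     forall i x, derivable (partials s f) x (delta_mx 0 i)).

(* C_c^oo(Omega) *)
Definition test_function (Omega : set 'rV[R]_n) f : Prop :=
  (forall k, Ck k f) /\
  exists2 K : set 'rV[R]_n, compact K /\ K `<=` Omega &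
    forall x, ~ K x -> f x = 0.

End smooth_functions.

Section domains.
Context {R : realType} (n : nat).
Implicit Types Omega : set 'rV[R]_n.

(* Near each boundary point, up to the choice and the orientation of one
   coordinate x_k, Omega is the strict epigraph of a C^2 function of the other
   coordinates. *)
Definition C2_boundary Omega : Prop :=
  forall x0, (closure Omega `\` interior Omega) x0 ->
  exists r : R, exists k : 'I_n, exists s : bool,
  exists gamma : 'rV[R]_n.-1 -> R,
    [/\ 0 < r, Ck 2 gamma &
      forall x, ball x0 r x ->
        Omega x <-> gamma (col' k x) < (-1) ^+ s * x 0 k].

(* Finite intersection of open half-spaces { x | a_i . x < c_i }; with
   boundedness, the interior of a convex polygon or polyhedron. *)
Definition convex_polytope Omega : Prop :=
  exists m, exists a : 'M[R]_(m, n), exists c : 'I_m -> R,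
    (forall i, row i a != 0) /\
    Omega = [set x | forall i, \sum_j a i j * x 0 j < c i].

Definition NSE_domain Omega : Prop :=
  [/\ open Omega, connected Omega, bounded_set Omega &
      C2_boundary Omega \/ convex_polytope Omega].

End domains.

Section square_integrable_fields.
Context {R : realType} {d : nat} (Omega : set 'rV[R]_d).

(* Fields with values in 'M_(m, n): vector fields are the case m = 1, their
   gradients the case m = n = d. They are genuine functions, not classes modulo
   almost everywhere equality on Omega. *)
Definition L2 m n (F : 'rV[R]_d -> 'M[R]_(m, n)) : Prop :=
  forall i j, measurable_fun Omega (fun x => F x i j) /\
    (leb d).-integrable Omega (EFin \o (fun x => F x i j ^+ 2)).

Definition inner m n (F G : 'rV[R]_d -> 'M[R]_(m, n)) : R :=
  \int[leb d]_(x in Omega) (\sum_i \sum_j F x i j * G x i j).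

Definition nrm m n (F : 'rV[R]_d -> 'M[R]_(m, n)) : R :=
  Num.sqrt (inner F F).

End square_integrable_fields.

Section sobolev.
Context {R : realType} {d : nat} (Omega : set 'rV[R]_d).

Local Notation field := ('rV[R]_d -> 'rV[R]_d).
Local Notation tensor := ('rV[R]_d -> 'M[R]_d).

Implicit Types (u v w phi chi : field) (G : tensor).

(* Entry (i, j) of the gradient of u is the derivative of u_j along x_i. *)
Definition classical_grad u : tensor :=
  fun x => \matrix_(i, j) partial i (fun y => u y 0 j) x.

Definition weak_grad u G : Prop :=
  forall (i j : 'I_d) (psi : 'rV[R]_d -> R), test_function Omega psi ->
    \int[leb d]_(x in Omega) (u x 0 j * partial i psi x) =
    - \int[leb d]_(x in Omega) (G x i j * psi x).

Definition test_field phi : Prop :=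
  forall j, test_function Omega (fun x => phi x 0 j).

(* u is in H^1, with weak gradient G, and is a limit in H^1 of test fields. *)
Definition H10_with_grad u G : Prop :=
  [/\ L2 Omega u, L2 Omega G, weak_grad u G &
    exists phi : nat -> field,
      [/\ forall k, test_field (phi k),
          nrm Omega (phi k - u) @[k --> \oo] --> (0 : R) &
          nrm Omega (classical_grad (phi k) - G) @[k --> \oo] --> (0 : R)]].

(* X = H_0^1(Omega)^d *)
Definition X u : Prop := exists G, H10_with_grad u G.

(* The weak gradient is determined up to a null subset of Omega; grad picks a
   representative, and is meaningful on X only. *)
Definition grad u : tensor := xget 0 (H10_with_grad u).

Definition V u : Prop :=
  X u /\ {ae leb d, forall x, Omega x -> \tr (grad u x) = 0}.

(* u . grad v *)
Definition convect u v : field := fun x => u x *m grad v x.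

Definition b u v w : R := inner Omega (convect u v) w.

(* b is a trilinear form on X: the integral defining it converges absolutely. *)
Definition b_defined : Prop := forall u v w, X u -> X v -> X w ->
  (leb d).-integrable Omega
    (EFin \o (fun x => \sum_j convect u v x 0 j * w x 0 j)).

Definition b_constant (M : R) : Prop := forall u v w, X u -> X v -> X w ->
  [/\ b u v w <= M * Num.sqrt (nrm Omega u) * Num.sqrt (nrm Omega (grad u)) *
                 nrm Omega (grad v) * nrm Omega (grad w),
      b u v w <= M * nrm Omega (grad u) * nrm Omega (grad v) *
                 nrm Omega (grad w) &
      b u v w <= M * nrm Omega (grad u) * nrm Omega (grad v) *
                 Num.sqrt (nrm Omega w) * Num.sqrt (nrm Omega (grad w))].

Definition poincare_constant (CP : R) : Prop :=
  forall phi, X phi -> nrm Omega phi <= CP * nrm Omega (grad phi).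

(* X' *)
Definition dual (f : field -> R) : Prop :=
  (forall a phi psi, X phi -> X psi ->
     f (a *: phi + psi) = a * f phi + f psi) /\
  exists C, forall phi, X phi -> `|f phi| <= C * nrm Omega (grad phi).

Definition dual_norm (f : field -> R) : R :=
  sup [set r | exists2 phi, X phi /\ nrm Omega (grad phi) != 0 &
                 r = `|f phi| / nrm Omega (grad phi)].

Definition NSE_weak_solution (nu : R) (f : field -> R) u : Prop :=
  V u /\ forall chi, V chi ->
    nu * inner Omega (grad u) (grad chi) + b u u chi = f chi.

Definition interpolation (IH : field -> field) (H CI : R) : Prop :=
  [/\ forall phi, X phi -> L2 Omega (IH phi),
      forall a phi psi, X phi -> X psi ->
        {ae leb d, forall x, Omega x ->
           IH (a *: phi + psi) x = a *: IH phi x + IH psi x},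
      forall phi, X phi -> nrm Omega (IH phi) <= CI * nrm Omega phi &
      forall phi, X phi ->
        nrm Omega (phi - IH phi) <= CI * H * nrm Omega (grad phi)].

Definition CDA_solution (hnu mu : R) (IH : field -> field) (f : field -> R)
    u v : Prop :=
  V v /\ forall chi, V chi ->
    hnu * inner Omega (grad v) (grad chi) + b v v chi +
      mu * inner Omega (IH (v - u)) (IH chi) = f chi.

End sobolev.

(* Main.v *)
Require Import Defs.
From mathcomp Require Import all_boot all_order all_algebra.
From mathcomp Require Import all_classical all_reals all_analysis.
From mathcomp Require Import measurable_realfun ring lra.

(** Put e = u - v. Testing both variational problems with e and subtracting
gives the energy identity
  hnu |grad e|^2 + mu |I_H e|^2 = (hnu - nu) (grad u, grad e) - b(e, u, e),
because the remaining convective term b(v, e, e) vanishes ([error_energy]).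
The left-hand side is bounded below by the standing bound on I_H. On the right,
Cauchy-Schwarz treats the first term, and the bound on b with |e|^(1/2)
|grad e|^(1/2), the energy bound nu |grad u| <= |f| and Young's inequality with
weight 1/8 treat the second one. If 18 C_I H M^2 |f|^2 <= nu^2 hnu^2, this
term is absorbed and
  3/8 hnu |grad e|^2 + 2/3 L |e|^2 <= |hnu - nu| |grad u| |grad e|
remains, where L = hnu / (2 C_I^2 H^2). Dropping the second term gives the
gradient estimate with constant 8/3 < 2 sqrt 2, and completing the square in
|grad e| gives the L^2 estimate ([error_estimate]).

The smallness condition is a competition between nu and hnu ([smallness]): if
nu <= 4 hnu it follows from the condition with the constant 46, and otherwise
from the condition on C_v, through the lower bound C_v >= |f| / hnu.

That b(v, w, w) = 0 for v in V and w in X ([b_skew_eq0]) is a density argument.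
For a test field phi the integrand of b(v, phi, phi) is half of v . grad |phi|^2,
and |phi|^2 is a test function, so the integral is minus half that of
(div v) |phi|^2, which is zero. Passing to the limit uses the bound on b, which
speaks of fields in X and of the gradients selected for them. So test fields
must belong to X ([H10_test]: integration by parts, obtained from Fubini's
theorem and the fundamental theorem of calculus in [integral_partial_eq0]), and
gradients must be unique almost everywhere ([H10_grad_uniq]), which also makes
the selected gradient linear up to null sets. *)

Set Implicit Arguments.
Unset Strict Implicit.
Unset Printing Implicit Defensive.

Import Order.TTheory GRing.Theory Num.Theory.
Import numFieldNormedType.Exports.

Local Open Scope classical_set_scope.
Local Open Scope ring_scope.

(** * Borel structure and compactly supported functions on row vectors *)

Section row_borel.
Context {R : realType} {n : nat}.

Lemma measurable_row_ball (x : 'rV[R]_n) (e : R) : measurable (ball x e).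
Proof.
have [e0|e0] := ltP 0 e; last first.
  rewrite (_ : ball x e = set0)//; apply/seteqP; split=> // y [e1 _].
  by move: e0; rewrite leNgt e1.
rewrite (_ : ball x e = \bigcap_(i in [set: 'I_n])
    (fun y : 'rV[R]_n => y 0 i) @^-1` ball (x 0 i) e); last first.
  apply/seteqP; split=> [y [_ H] i _|y H]; first exact: H.
  by split=> // i j; rewrite ord1; exact: H.
apply: fin_bigcap_measurable => // i _.
rewrite -[X in measurable X]setTI; apply: measurable_coord => //.
exact: measurable_ball.
Qed.

(** The sigma-algebra is generated by the coordinates, so it contains the balls
    of the maximum norm; an open set is a countable union of such balls, with
    rational centers and radii [k.+1%:R^-1]. *)
Lemma open_measurable_row (A : set 'rV[R]_n) : open A -> measurable A.
Proof.
move=> oA.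
pose q2r (q : 'rV[rat]_n) : 'rV[R]_n := map_mx ratr q.
pose F (p : 'rV[rat]_n * nat) : set 'rV[R]_n :=
  if `[< ball (q2r p.1) (p.2.+1%:R^-1) `<=` A >]
  then ball (q2r p.1) (p.2.+1%:R^-1) else set0.
suff -> : A = \bigcup_p F p.
  apply: countable_bigcupT_measurable => // p; rewrite /F.
  by case: ifP => // _; exact: measurable_row_ball.
apply/seteqP; split=> [x Ax|x [p _]]; last first.
  by rewrite /F; case: ifP => // /asboolP; exact.
have /nbhs_ballP[e /= e0 xeA] : nbhs x A by exact: open_nbhs_nbhs.
have [k ke] : exists k : nat, k.+1%:R^-1 < e / 2.
  have e20 : 0 < (e / 2)^-1 by rewrite invr_gt0 divr_gt0.
  exists (Num.truncn (e / 2)^-1); rewrite invf_plt ?posrE ?divr_gt0//.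
  by rewrite truncnS_gt// ltW.
have k0 : (0 : R) < k.+1%:R^-1 by rewrite invr_gt0.
have /choice[q Hq] : forall i, exists q : rat,
    ball (x 0 i) k.+1%:R^-1 (ratr q : R).
  move=> i; have : x 0 i - k.+1%:R^-1 < x 0 i + k.+1%:R^-1.
    by rewrite ltrD2l (lt_trans _ k0)// oppr_lt0.
  move=> /rat_in_itvoo[q]; rewrite in_itv/= => qE; exists q.
  by rewrite /ball/= ltr_distlC.
exists (\row_i q i, k) => //; rewrite /F/=.
have Bx : ball (q2r (\row_i q i)) k.+1%:R^-1 x.
  split=> // i j; rewrite ord1 !mxE; apply: ball_sym; exact: Hq.
rewrite ifT//; apply/asboolP => y By; apply: xeA.
apply: (@le_ball _ _ _ (k.+1%:R^-1 + k.+1%:R^-1)).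
  by rewrite [leRHS]splitr lerD// ltW.
by apply: ball_triangle By; exact: ball_sym.
Qed.

Lemma continuous_measurable_row (f : 'rV[R]_n -> R) :
  continuous f -> measurable_fun [set: 'rV[R]_n] f.
Proof.
move=> cf; apply: (measurability _ (RGenOpens.measurableE R)) => //.
move=> _ [_ [a [b ->] <-]]; rewrite setTI.
apply: open_measurable_row; move/continuousP : cf; apply.
exact: interval_open.
Qed.

Definition box (r : R) : set 'rV[R]_n := [set x | forall i, `|x 0 i| <= r].

Lemma measurable_box r : measurable (box r).
Proof.
rewrite (_ : box r = \bigcap_(i in [set: 'I_n])
    (fun y : 'rV[R]_n => y 0 i) @^-1` `[- r, r]%classic); last first.
  apply/seteqP; split=> [y H i _|y H i] /=.
    by rewrite in_itv/= -ler_norml; exact: H.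
  by have := H i I; rewrite /= in_itv/= -ler_norml.
apply: fin_bigcap_measurable => // i _.
by rewrite -[X in measurable X]setTI; exact: measurable_coord.
Qed.

Lemma closed_box r : closed (box r).
Proof.
rewrite (_ : box r = \bigcap_(i in [set: 'I_n])
    (fun y : 'rV[R]_n => y 0 i) @^-1` `[- r, r]%classic); last first.
  apply/seteqP; split=> [y H i _|y H i] /=.
    by rewrite in_itv/= -ler_norml; exact: H.
  by have := H i I; rewrite /= in_itv/= -ler_norml.
apply: closed_bigI => i _; apply: preimage_closed => //.
  by move=> x _; exact: coord_continuous.
exact: interval_closed.
Qed.

Lemma normr_le_box (x : 'rV[R]_n) r : 0 <= r -> (`|x| <= r) <-> box r x.
Proof.
move=> r0; rewrite [`|x|]mx_normrE; split.
  by move=> /bigmax_leP[_ H] i; apply: (H (0, i)).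
by move=> H; apply/bigmax_leP; split=> // -[i j] _ /=; rewrite ord1; exact: H.
Qed.

End row_borel.

Lemma leb_box_lty {R : realType} n (r : R) : (leb n (@box R n r) < +oo)%E.
Proof.
elim: n => [|n IH] /=; first by rewrite diracE ltry.
rewrite /lebesgue_step/= /pushforward.
rewrite (_ : _ @^-1` _ = `[- r, r]%classic `*` @box R n r); last first.
  rewrite /row_cons; apply/seteqP; split=> [[a t]|[a t]] /=.
    move=> H; split=> /=.
      have := H (@lshift 1 n 0); rewrite in_itv/= -ler_norml.
      by rewrite (row_mxEl (a%:M : 'rV[R]_1) t 0 0) mxE.
    by move=> i; have := H (@rshift 1 n i); rewrite (row_mxEr (a%:M : 'rV[R]_1) t 0 i).
  move=> [/=]; rewrite in_itv/= -ler_norml => ar tr i.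
  case: (@split_ordP 1 n i) => j ->.
    by rewrite (row_mxEl (a%:M : 'rV[R]_1) t 0 j) ord1 mxE.
  by rewrite (row_mxEr (a%:M : 'rV[R]_1) t 0 j).
rewrite product_measure1E//; last exact: measurable_box.
rewrite lte_mul_pinfty//.
have : (@lebesgue_measure R `[(- r)%R, r]%classic < +oo)%E.
  by rewrite lebesgue_measure_itv; case: ifP; rewrite // -EFinB ltry.
by rewrite -ge0_fin_numE.
Qed.

Section compact_support.
Context {R : realType}.

(** Boxes rather than compact sets, because a slice of a box is a box. *)
Definition box_supported n (g : 'rV[R]_n -> R) : Prop :=
  exists r, forall x, ~ box r x -> g x = 0.

Lemma continuous_box_bounded n (g : 'rV[R]_n -> R) :
  continuous g -> box_supported g -> exists M, forall x, `|g x| <= M.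
Proof.
move=> cg [r gr]; pose r' := Num.max 0 r.
have r'0 : 0 <= r' by rewrite le_max lexx.
have cK : compact (@box R n r').
  apply: bounded_closed_compact; last exact: closed_box.
  exists r'; split; first exact: num_real.
  by move=> s /ltW rs x /(normr_le_box _ r'0) /le_trans; apply.
have /compact_bounded[M [_ HM]] : compact (g @` @box R n r').
  by apply: continuous_compact => //; exact: continuous_subspaceT.
exists (`|M| + 1) => x; have [bx|bx] := pselect (box r' x).
  by apply: HM; [rewrite (le_lt_trans (ler_norm _))// ltrDl|exists x].
rewrite gr ?normr0 ?addr_ge0// => bx'; apply: bx => i.
by rewrite (le_trans (bx' i))// le_max lexx orbT.
Qed.

Lemma continuous_box_integrable n (g : 'rV[R]_n -> R) :
  continuous g -> box_supported g -> (leb n).-integrable setT (EFin \o g).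
Proof.
move=> cg gbox; have [M gM] := continuous_box_bounded cg gbox.
have [r gr] := gbox.
have mb : measurable (@box R n r) by exact: measurable_box.
have -> : EFin \o g = (EFin \o g) \_ (box r).
  apply/funext => x; rewrite patchE; case: ifPn => // /negP.
  by rewrite inE => /gr /= ->.
apply/(integrable_restrict _ mb) => //; rewrite setTI.
apply: measurable_bounded_integrable => //.
- exact: leb_box_lty.
- apply: measurable_funS (continuous_measurable_row cg) => //.
- exists M; split; first exact: num_real.
  by move=> s /ltW Ms x _; exact: le_trans Ms.
Qed.

End compact_support.

(** * Slices of functions on row vectors *)

Section integral_partial.
Context {R : realType}.

(** A directional derivative depends only on the restriction of the function to
    a line. *)
Lemma derive_line (V W : normedModType R) (f : V -> R) (g : W -> R) x v y w :
  (forall h, f (h *: v + x) = g (h *: w + y)) ->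
  ('D_v f x = 'D_w g y) * (derivable f x v <-> derivable g y w).
Proof.
move=> fg; rewrite /derive /derivable.
have -> : (fun h => h^-1 *: ((f \o shift x) (h *: v) - f x)) =
  (fun h => h^-1 *: ((g \o shift y) (h *: w) - g y)).
  apply/funext => h /=; rewrite fg.
  by have := fg 0; rewrite !scale0r !add0r => ->.
by split.
Qed.

Lemma derive_eq0_off (V : normedModType R) (f : V -> R) (K : set V) x v :
  closed K -> (forall y, ~ K y -> f y = 0) -> ~ K x -> 'D_v f x = 0.
Proof.
move=> cK fK Kx.
have : \forall y \near x, f y = (cst 0 : V -> R) y.
  have : nbhs x (~` K) by apply: open_nbhs_nbhs; split=> //; exact: closed_openC.
  by apply: filterS => y /fK.
by move=> /near_eq_derive ->; rewrite derive_cst.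
Qed.

(** The fundamental theorem of calculus on a segment whose end points lie outside
    the support. *)
Lemma integral_derive1_eq0 (g : R -> R) (r : R) :
  continuous g -> (forall x, derivable g x 1) -> continuous ('D_1 g) ->
  (forall x, r < `|x| -> g x = 0) ->
  (\int[lebesgue_measure]_x ('D_1 g x)%:E = 0)%E.
Proof.
move=> cg dg cdg gr; pose s := Num.max 0 r + 1.
have s0 : 0 < s by rewrite ltr_wpDl// le_max lexx.
have rs : r < s.
  by rewrite (@le_lt_trans _ _ (Num.max 0 r)) ?ltrDl// le_max lexx orbT.
have zs x : s <= `|x| -> g x = 0 by move=> sx; apply: gr; exact: lt_le_trans sx.
have D0 x : ~ `[- s, s]%classic x -> 'D_1 g x = 0.
  apply: derive_eq0_off; first exact: interval_closed.
  move=> y; rewrite /= in_itv/= -ler_norml => /negP; rewrite -ltNge => sy.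
  by apply: zs; exact: ltW.
have -> : (\int[lebesgue_measure]_x ('D_1 g x)%:E =
    \int[lebesgue_measure]_(x in `[(- s)%R, s]) ('D_1 g x)%:E)%E.
  rewrite [RHS]integral_mkcond; apply: eq_integral => x _ /=.
  rewrite patchE; case: ifPn => // /negP; rewrite inE => /D0 -> //.
rewrite (continuous_FTC2 (F := g)).
- by rewrite !zs ?normrN ?(ger0_norm (ltW s0))// subee.
- by rewrite gt0_cp.
- exact: continuous_subspaceT.
- split; first by move=> x _; exact: dg.
    by apply: cvg_at_right_filter; exact: cg.
  by apply: cvg_at_left_filter; exact: cg.
- by move=> x _; rewrite derive1E.
Qed.

Variable n : nat.

Lemma row_cons_lshift (a : R) (t : 'rV[R]_n) : row_cons (a, t) 0 (@lshift 1 n 0) = a.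
Proof. by rewrite (row_mxEl (a%:M : 'rV[R]_1) t 0 0) mxE. Qed.

Lemma row_cons_rshift (a : R) (t : 'rV[R]_n) j :
  row_cons (a, t) 0 (@rshift 1 n j) = t 0 j.
Proof. by rewrite (row_mxEr (a%:M : 'rV[R]_1) t 0 j). Qed.

Lemma eq_row_cons (x : 'rV[R]_n.+1) (a : R) (t : 'rV[R]_n) :
  x 0 (@lshift 1 n 0) = a -> (forall j, x 0 (@rshift 1 n j) = t 0 j) ->
  x = row_cons (a, t).
Proof.
move=> xa xt; apply/rowP => i; case: (@split_ordP 1 n i) => j ->.
  by rewrite ord1 xa row_cons_lshift.
by rewrite xt row_cons_rshift.
Qed.

Lemma cvg_rV (T : Type) (F : set_system T) (FF : Filter F) m
    (f : T -> 'rV[R]_m) (l : 'rV[R]_m) :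
  (forall i, f x 0 i @[x --> F] --> l 0 i) -> f @ F --> l.
Proof.
move=> fl; apply/cvg_ballP => e e0.
have : \forall x \near F, forall i, ball (l 0 i) e (f x 0 i).
  by apply: filter_forall => i; move: (fl i) => /cvg_ballP; exact.
by apply: filterS => x H; split=> // i j; rewrite ord1; exact: H.
Qed.

Lemma continuous_rV (T : topologicalType) m (f : T -> 'rV[R]_m) :
  (forall i, continuous (fun x => f x 0 i)) -> continuous f.
Proof. by move=> H x; apply: cvg_rV => i; exact: H. Qed.

Lemma continuous_row_cons1 (t : 'rV[R]_n) :
  continuous (fun a : R => row_cons (a, t)).
Proof.
apply: continuous_rV => i; case: (@split_ordP 1 n i) => j ->.
  rewrite ord1; under eq_fun do rewrite row_cons_lshift.
  by move=> a; exact: cvg_id.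
under eq_fun do rewrite row_cons_rshift.
exact: cst_continuous.
Qed.

Lemma continuous_row_cons2 (a : R) :
  continuous (fun t : 'rV[R]_n => row_cons (a, t)).
Proof.
apply: continuous_rV => i; case: (@split_ordP 1 n i) => j ->.
  rewrite ord1; under eq_fun do rewrite row_cons_lshift.
  exact: cst_continuous.
under eq_fun do rewrite row_cons_rshift.
exact: coord_continuous.
Qed.

Lemma partial_row_cons1 (g : 'rV[R]_n.+1 -> R) (a : R) t :
  (partial (@lshift 1 n 0) g (row_cons (a, t)) =
     'D_1 (fun a' : R => g (row_cons (a', t))) a) *
  (derivable g (row_cons (a, t)) (delta_mx 0 (@lshift 1 n 0)) <->
    derivable (fun a' : R => g (row_cons (a', t))) a 1).
Proof.
apply: derive_line => h; congr g; apply: eq_row_cons => [|j].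
  by rewrite mxE row_cons_lshift !mxE !eqxx.
by rewrite mxE row_cons_rshift !mxE eq_rlshift andbF mulr0 add0r.
Qed.

Lemma partial_row_cons2 (g : 'rV[R]_n.+1 -> R) (a : R) t i :
  (partial (@rshift 1 n i) g (row_cons (a, t)) =
     partial i (fun t' => g (row_cons (a, t'))) t) *
  (derivable g (row_cons (a, t)) (delta_mx 0 (@rshift 1 n i)) <->
    derivable (fun t' => g (row_cons (a, t'))) t (delta_mx 0 i)).
Proof.
apply: derive_line => h; congr g; apply: eq_row_cons => [|j].
  by rewrite mxE row_cons_lshift !mxE eq_lrshift andbF mulr0 add0r.
by rewrite mxE row_cons_rshift !mxE eq_rshift.
Qed.

End integral_partial.

(** * Integrals of partial derivatives *)

Section fubini_row.
Context {R : realType}.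
Local Notation lam := (@lebesgue_measure R).

Lemma fubini_row n (F : 'rV[R]_n.+1 -> R) :
  continuous F -> box_supported F ->
  (\int[leb n.+1]_x (F x)%:E =
     \int[lam]_a \int[leb n]_t (F (row_cons (a, t)))%:E)%E /\
  (\int[leb n.+1]_x (F x)%:E =
     \int[leb n]_t \int[lam]_a (F (row_cons (a, t)))%:E)%E.
Proof.
move=> cF bF; have iF := continuous_box_integrable cF bF.
have mF : measurable_fun setT (EFin \o F).
  by apply/measurable_EFinP; exact: continuous_measurable_row.
have mc := @measurable_row_cons R n.
have iFc : (product_measure1 lam (leb n)).-integrable setT
    ((EFin \o F) \o @row_cons R n).
  apply/integrableP; split; first exact: measurableT_comp.
  move/integrableP : iF => [_]; apply: le_lt_trans.
  rewrite [leRHS]ge0_integral_pushforward//.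
  exact: measurableT_comp.
have E1 : (\int[leb n.+1]_x (F x)%:E = \int[product_measure1 lam (leb n)]_z
    ((EFin \o F) \o @row_cons R n) z)%E.
  by rewrite /= (@integral_pushforward _ _ _ _ _ _ mc _ setT).
split.
  by rewrite E1 -integral12_prod_meas1.
by rewrite E1 -integral21_prod_meas1.
Qed.

(** By Fubini's theorem one may integrate first along the coordinates that
    contain the direction of derivation: for the first coordinate the inner
    integral vanishes by the fundamental theorem of calculus, for the others by
    induction on the dimension. *)
Lemma integral_partial_eq0 n (i : 'I_n) (g : 'rV[R]_n -> R) :
  continuous g -> box_supported g ->
  (forall x, derivable g x (delta_mx 0 i)) -> continuous (partial i g) ->
  (\int[leb n]_x (partial i g x)%:E = 0)%E.
Proof.
elim: n i g => [[]//|n IH] i g cg [r gr] dg cdg.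
have gr' x : ~ box r x -> partial i g x = 0.
  by apply: derive_eq0_off => //; exact: closed_box.
have [E1 E2] := fubini_row cdg (ex_intro _ r gr').
case: (@split_ordP 1 n i) => j ij.
- rewrite E2; apply: integral0_eq => t _.
  apply: (etrans (y := (\int[lam]_a ('D_1 (fun a' : R => g (row_cons (a', t))) a)%:E)%E)).
    by apply: eq_integral => a _; rewrite ij ord1 (partial_row_cons1 g _ t).1.
  apply: (@integral_derive1_eq0 _ (fun a => g (row_cons (a, t))) r).
  + move=> a; apply: continuous_comp; last exact: cg.
    exact: continuous_row_cons1.
  + move=> a; move: (dg (row_cons (a, t))); rewrite ij ord1.
    by move=> /(partial_row_cons1 g a t).2.
  + have -> : 'D_1 (fun a : R => g (row_cons (a, t))) =
        partial i g \o (fun a : R => row_cons (a, t)).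
      by apply/funext => a /=; rewrite ij ord1 (partial_row_cons1 g _ t).1.
    move=> a; apply: continuous_comp; last exact: cdg.
    exact: continuous_row_cons1.
  + move=> a ra; apply: gr => /(_ (@lshift 1 n 0)).
    by rewrite row_cons_lshift leNgt ra.
- rewrite E1; apply: integral0_eq => a _.
  rewrite (eq_integral
    (fun t => (partial j (fun t' => g (row_cons (a, t'))) t)%:E)); last first.
    by move=> t _; rewrite ij (partial_row_cons2 g a _ _).1.
  apply: IH.
  + move=> t; apply: continuous_comp; last exact: cg.
    exact: continuous_row_cons2.
  + exists r => t bt; apply: gr => bat; apply: bt => k.
    by rewrite -(row_cons_rshift a).
  + move=> t; move: (dg (row_cons (a, t))); rewrite ij.
    by move=> /(partial_row_cons2 g a t j).2.
  + have -> : partial j (fun t => g (row_cons (a, t))) =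
        partial i g \o (fun t => row_cons (a, t)).
      by apply/funext => t /=; rewrite ij (partial_row_cons2 g a _ _).1.
    move=> t; apply: continuous_comp; last exact: cdg.
    exact: continuous_row_cons2.
Qed.

End fubini_row.

(** * Smooth functions and test functions *)

Section smooth_closure.
Context {R : realType} (n : nat).
Implicit Types f g : 'rV[R]_n -> R.

Lemma CkW k l f : (l <= k)%N -> Ck k f -> Ck l f.
Proof.
move=> lk Hf s sl; have [c d] := Hf s (leq_trans sl lk).
by split=> // sl' i x; apply: d; exact: leq_trans lk.
Qed.

Lemma Ck_continuous k f : Ck k f -> continuous f.
Proof. by move=> /(_ [::] isT)[]. Qed.

(** [partials] differentiates first in the direction that comes last in the
    list; peeling it off describes C^k recursively, which makes the closure
    properties provable by induction on [k]. *)
Lemma CkS k f : Ck k.+1 f <->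
  continuous f /\ forall i, (forall x, derivable f x (delta_mx 0 i)) /\
                            Ck k (partial i f).
Proof.
split=> [Hf|[cf Hf] s].
  split=> [|i]; first exact: Ck_continuous Hf.
  split=> [x|s sk]; first by have [_] := Hf [::] isT; exact.
  have := Hf (rcons s i); rewrite size_rcons ltnS => /(_ sk).
  by rewrite /partials foldr_rcons.
case: (lastP s) => [_|s' i].
  by split=> // _ i x; exact: (Hf i).1.
rewrite size_rcons ltnS => sk; have := (Hf i).2 s' sk.
by rewrite /partials foldr_rcons ltnS.
Qed.

Lemma partialD i f g : (forall x, derivable f x (delta_mx 0 i)) ->
  (forall x, derivable g x (delta_mx 0 i)) ->
  partial i (f + g) = partial i f + partial i g.
Proof. by move=> df dg; apply/funext => x; rewrite /partial deriveD. Qed.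

Lemma partialZ i (a : R) f : (forall x, derivable f x (delta_mx 0 i)) ->
  partial i (a *: f) = a *: partial i f.
Proof. by move=> df; apply/funext => x; rewrite /partial deriveZ. Qed.

Lemma partialM i f g : (forall x, derivable f x (delta_mx 0 i)) ->
  (forall x, derivable g x (delta_mx 0 i)) ->
  partial i (f * g) = f * partial i g + g * partial i f.
Proof. by move=> df dg; apply/funext => x; rewrite /partial deriveM. Qed.

Lemma CkD k f g : Ck k f -> Ck k g -> Ck k (f + g).
Proof.
elim: k f g => [|k IH] f g.
  move=> /Ck_continuous cf /Ck_continuous cg [|//] _; split=> //.
  by move=> x; apply: continuousD; [exact: cf|exact: cg].
move=> /CkS[cf Hf] /CkS[cg Hg]; apply/CkS; split.
  by move=> x; apply: continuousD; [exact: cf|exact: cg].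
move=> i; have [df Cf] := Hf i; have [dg Cg] := Hg i; split.
  by move=> x; exact: derivableD.
by rewrite partialD//; exact: IH.
Qed.

Lemma CkZ k (a : R) f : Ck k f -> Ck k (a *: f).
Proof.
elim: k f => [|k IH] f.
  move=> /Ck_continuous cf [|//] _; split=> //.
  by move=> x; apply: continuousZr; exact: cf.
move=> /CkS[cf Hf]; apply/CkS; split.
  by move=> x; apply: continuousZr; exact: cf.
move=> i; have [df Cf] := Hf i; split.
  by move=> x; exact: derivableZ.
by rewrite partialZ//; exact: IH.
Qed.

Lemma CkM k f g : Ck k f -> Ck k g -> Ck k (f * g).
Proof.
elim: k f g => [|k IH] f g.
  move=> /Ck_continuous cf /Ck_continuous cg [|//] _; split=> //.
  by move=> x; apply: continuousM; [exact: cf|exact: cg].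
move=> Cf1 Cg1; have Cf0 := CkW (leqnSn k) Cf1; have Cg0 := CkW (leqnSn k) Cg1.
move: Cf1 Cg1 => /CkS[cf Hf] /CkS[cg Hg]; apply/CkS; split.
  by move=> x; apply: continuousM; [exact: cf|exact: cg].
move=> i; have [df Cf] := Hf i; have [dg Cg] := Hg i; split.
  by move=> x; exact: derivableM.
by rewrite partialM//; apply: CkD; exact: IH.
Qed.

End smooth_closure.

Section test_functions.
Context {R : realType} {n : nat} (Omega : set 'rV[R]_n).
Implicit Types f g : 'rV[R]_n -> R.
Local Notation test := (test_function Omega).

Lemma test_continuous f : test f -> continuous f.
Proof. by move=> [/(_ 0%N)/Ck_continuous]. Qed.

Lemma test_derivable f i x : test f -> derivable f x (delta_mx 0 i).
Proof. by move=> [/(_ 1%N)/CkS[_ /(_ i)[]]]. Qed.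

Lemma test_off f x : test f -> ~ Omega x -> f x = 0.
Proof. by move=> [_ [K [_ KO] H]] Ox; apply: H => /KO. Qed.

Lemma test_box f : test f -> box_supported f.
Proof.
move=> [_ [K [/compact_bounded[M [_ HM]] _] Kf]].
have M0 : 0 <= `|M| + 1 by rewrite addr_ge0.
exists (`|M| + 1) => x bx; apply: Kf => Kx; apply: bx.
apply/normr_le_box => //; apply: HM => //.
by rewrite (le_lt_trans (ler_norm _))// ltrDl.
Qed.

Lemma test_partial i f : test f -> test (partial i f).
Proof.
move=> [Hf [K [cK KO] Kf]]; split.
  by move=> k; have /CkS[_ /(_ i)[]] := Hf k.+1.
exists K => // x Kx; apply: derive_eq0_off Kf Kx.
by apply: compact_closed => //; exact: norm_hausdorff.
Qed.

Lemma testD f g : test f -> test g -> test (f + g).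
Proof.
move=> [Hf [K [cK KO] Kf]] [Hg [L [cL LO] Lg]]; split.
  by move=> k; exact: CkD.
exists (K `|` L).
  by split; [exact: compactU|rewrite subUset].
by move=> x /not_orP[/Kf fx /Lg gx]; rewrite /= fctE fx gx addr0.
Qed.

Lemma testZ (a : R) f : test f -> test (a *: f).
Proof.
move=> [Hf [K cK Kf]]; split; first by move=> k; exact: CkZ.
by exists K => // x /Kf fx; rewrite fctE fx scaler0.
Qed.

Lemma testM f g : test f -> test g -> test (f * g).
Proof.
move=> [Hf [K cK Kf]] [Hg _]; split; first by move=> k; exact: CkM.
by exists K => // x /Kf fx; rewrite fctE fx mul0r.
Qed.

Lemma test0 : test 0.
Proof.
split=> [k|]; last first.
  by exists set0 => //; split=> //; exact: compact0.
elim: k => [[|//] _|k IH].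
  by split=> //; exact: cst_continuous.
have d0 i (x : 'rV[R]_n) : derivable (0 : 'rV[R]_n -> R) x (delta_mx 0 i).
  exact: derivable_cst.
apply/CkS; split; first exact: cst_continuous.
move=> i; split; first exact: d0.
suff -> : partial i (0 : 'rV[R]_n -> R) = 0 by [].
by apply/funext => x; rewrite /partial derive_cst.
Qed.

Hypothesis mO : measurable Omega.

Lemma continuous_Omega_integrable f : continuous f -> box_supported f ->
  (leb n).-integrable Omega (EFin \o f).
Proof.
move=> cf bf; apply: integrableS (continuous_box_integrable cf bf) => //.
Qed.

Lemma test_integrable f : test f -> (leb n).-integrable Omega (EFin \o f).
Proof.
by move=> tf; apply: continuous_Omega_integrable;
  [exact: test_continuous|exact: test_box].
Qed.

Lemma test_measurable f : test f -> measurable_fun Omega f.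
Proof.
by move=> /test_continuous/continuous_measurable_row; exact: measurable_funS.
Qed.

Lemma integral_test_partial i f : test f ->
  \int[leb n]_(x in Omega) partial i f x = 0.
Proof.
move=> tf; rewrite Rintegral_mkcond.
have -> : partial i f \_ Omega = partial i f.
  apply/funext => x; rewrite patchE; case: ifPn => // /negP.
  by rewrite inE => /(test_off (test_partial i tf)).
rewrite /Rintegral integral_partial_eq0//.
- exact: test_continuous.
- exact: test_box.
- by move=> x; exact: test_derivable.
- exact/test_continuous/test_partial.
Qed.

(** The integral of the derivative of the product vanishes, since the product is
    a test function. *)
Lemma test_by_parts i f g : test f -> test g ->
  \int[leb n]_(x in Omega) (f x * partial i g x) =
  - \int[leb n]_(x in Omega) (partial i f x * g x).
Proof.
move=> tf tg; apply/eqP; rewrite -addr_eq0; apply/eqP.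
have tfp := test_partial i tf; have tgp := test_partial i tg.
rewrite -RintegralD//.
- rewrite -[RHS](integral_test_partial i (testM tf tg)).
  rewrite partialM => [|x|x]; try exact: test_derivable.
  by apply: eq_Rintegral => x _; rewrite !fctE [in RHS](mulrC (g x)).
- exact: test_integrable (testM tf tgp).
- exact: test_integrable (testM tfp tg).
Qed.

End test_functions.

(** * Square integrable fields *)

Section Rintegral_extra.
Context {dsp : measure_display} {T : measurableType dsp} {R : realType}.
Variables (mu : {measure set T -> \bar R}) (D : set T).
Hypothesis mD : measurable D.
Implicit Types f g : T -> R.

Definition rint f := mu.-integrable D (EFin \o f).

Lemma rint_measurable f : rint f -> measurable_fun D f.
Proof. by move=> /integrableP[/measurable_EFinP]. Qed.

Lemma rintD f g : rint f -> rint g -> rint (fun x => f x + g x).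
Proof. exact: integrableD. Qed.

Lemma rintZ (a : R) f : rint f -> rint (fun x => a * f x).
Proof. exact: integrableZl. Qed.

Lemma rint_sum I (s : seq I) (h : I -> T -> R) :
  (forall i, rint (h i)) -> rint (fun x => \sum_(i <- s) h i x).
Proof.
move=> Hh; elim: s => [|i s IH].
  rewrite (_ : (fun x => _) = cst 0); last by apply/funext => x; rewrite big_nil.
  exact: integrable0.
rewrite (_ : (fun x => _) = (fun x => h i x + \sum_(j <- s) h j x)); last first.
  by apply/funext => x; rewrite big_cons.
exact: rintD.
Qed.

Lemma Rintegral_sum I (s : seq I) (h : I -> T -> R) :
  (forall i, rint (h i)) ->
  \int[mu]_(x in D) (\sum_(i <- s) h i x) =
  \sum_(i <- s) \int[mu]_(x in D) h i x.
Proof.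
move=> Hh; elim: s => [|i s IH].
  rewrite big_nil -[RHS](mul0r (fine (mu D))) -Rintegral_cst//.
  by apply: eq_Rintegral => x _; rewrite big_nil.
rewrite big_cons -IH -RintegralD//; [|exact: Hh|exact: rint_sum].
by apply: eq_Rintegral => x _; rewrite big_cons.
Qed.

Lemma ae_eq_Rintegral f g : measurable_fun D f -> measurable_fun D g ->
  {ae mu, forall x, D x -> f x = g x} ->
  \int[mu]_(x in D) f x = \int[mu]_(x in D) g x.
Proof.
move=> mf mg fg; congr fine; apply: ae_eq_integral => //; try exact/measurable_EFinP.
by apply: filterS fg => x /[apply] ->.
Qed.

Definition sq_int f : Prop :=
  measurable_fun D f /\ rint (fun x => f x ^+ 2).

Lemma sq_intM f g : sq_int f -> sq_int g -> rint (fun x => f x * g x).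
Proof.
move=> [mf If] [mg Ig].
apply: (le_integrable mD _ _ (rintD If Ig)).
  by apply/measurable_EFinP; exact: measurable_funM.
move=> x _; rewrite /= lee_fin (@ger0_norm _ (_ + _)) ?addr_ge0 ?sqr_ge0//.
rewrite ler_norml; apply/andP; split.
  by rewrite -subr_ge0; have := sqr_ge0 (f x + g x); have := sqr_ge0 (f x);
     have := sqr_ge0 (g x); nra.
by rewrite -subr_ge0; have := sqr_ge0 (f x - g x); have := sqr_ge0 (f x);
   have := sqr_ge0 (g x); nra.
Qed.

Lemma sq_intD f g : sq_int f -> sq_int g -> sq_int (fun x => f x + g x).
Proof.
move=> sf sg; have [mf If] := sf; have [mg Ig] := sg; split.
  exact: measurable_funD.
have := rintD (rintD If Ig) (rintZ 2 (sq_intM sf sg)).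
rewrite /rint; congr (_.-integrable _ _); apply/funext => x /=.
by congr EFin; ring.
Qed.

Lemma sq_intZ (a : R) f : sq_int f -> sq_int (fun x => a * f x).
Proof.
move=> [mf If]; split.
  by apply: measurable_funM => //; exact: measurable_cst.
have := rintZ (a ^+ 2) If.
by rewrite /rint; congr (_.-integrable _ _); apply/funext => x /=; rewrite exprMn.
Qed.

End Rintegral_extra.

Lemma quadratic_form_ge0 (R : realFieldType) (a b c : R) : 0 <= c ->
  (forall t s, 0 <= t ^+ 2 * a + 2 * t * s * b + s ^+ 2 * c) -> b ^+ 2 <= a * c.
Proof.
move=> c0 E; have a0 : 0 <= a by have := E 1 0; rewrite !expr2; lra.
have [c_eq0|cn0] := eqVneq c 0.
  (* The form is then affine in s: s = - (a + 1) makes it negative unless b = 0. *)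
  have := E b (- (a + 1)); rewrite c_eq0.
  rewrite [X in 0 <= X](_ : _ = - (b ^+ 2 * (a + 2))); last by ring.
  rewrite oppr_ge0 pmulr_lle0; last by lra.
  by rewrite mulr0.
have cp : 0 < c by rewrite lt_def cn0.
have := E c (- b).
rewrite [X in 0 <= X](_ : _ = c * (a * c - b ^+ 2)); last by ring.
by rewrite pmulr_rge0// subr_ge0.
Qed.

Section L2_space.
Context {R : realType} {d : nat} (Omega : set 'rV[R]_d).
Hypothesis mO : measurable Omega.
Local Notation ae P := {ae leb d, forall x, Omega x -> P x}.
Variables m n : nat.
Implicit Types F G K : 'rV[R]_d -> 'M[R]_(m, n).
Local Notation L2 := (L2 Omega).
Local Notation inner := (inner Omega).
Local Notation nrm := (nrm Omega).

Lemma L2_lin (a : R) F G : L2 F -> L2 G -> L2 (a *: F + G).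
Proof.
move=> HF HG i j.
suff : sq_int (leb d) Omega (fun x => (a *: F + G) x i j) by [].
rewrite (_ : (fun x => _) = (fun x => a * F x i j + G x i j)); last first.
  by apply/funext => x; rewrite !fctE !mxE.
exact: (sq_intD mO (sq_intZ mO a (HF i j)) (HG i j)).
Qed.

Lemma L2D F G : L2 F -> L2 G -> L2 (F + G).
Proof. by move=> HF HG; rewrite -[F]scale1r; exact: L2_lin. Qed.

Lemma L2_0 : L2 (0 : 'rV[R]_d -> 'M[R]_(m, n)).
Proof.
move=> i j; rewrite (_ : (fun x => _) = cst 0); last first.
  by apply/funext => x; rewrite !fctE !mxE.
split; first exact: measurable_cst.
rewrite (_ : (EFin \o _) = cst 0%E); first exact: integrable0.
by apply/funext => x /=; rewrite mxE expr0n.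
Qed.

Lemma L2Z (a : R) F : L2 F -> L2 (a *: F).
Proof. by move=> HF; rewrite -[_ *: _]addr0; apply: L2_lin => //; exact: L2_0. Qed.

Lemma L2B F G : L2 F -> L2 G -> L2 (F - G).
Proof. by move=> HF HG; rewrite addrC -scaleN1r; exact: L2_lin. Qed.

Lemma inner_rint F G : L2 F -> L2 G ->
  rint (leb d) Omega (fun x => \sum_i \sum_j F x i j * G x i j).
Proof.
move=> HF HG; apply: rint_sum => // i; apply: rint_sum => // j.
exact: sq_intM.
Qed.

Lemma inner_linl (a : R) F G K : L2 F -> L2 G -> L2 K ->
  inner (a *: F + G) K = a * inner F K + inner G K.
Proof.
move=> HF HG HK; rewrite /Defs.inner -RintegralZl//; last exact: inner_rint.
rewrite -RintegralD//; [|exact/rintZ/inner_rint|exact: inner_rint].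
apply: eq_Rintegral => x _; rewrite mulr_sumr -big_split; apply: eq_bigr => i _.
rewrite mulr_sumr -big_split; apply: eq_bigr => j _.
by rewrite !fctE !mxE mulrDl mulrA.
Qed.

Lemma innerC F G : inner F G = inner G F.
Proof.
apply: eq_Rintegral => x _; apply: eq_bigr => i _; apply: eq_bigr => j _.
by rewrite mulrC.
Qed.

Lemma innerDl F G K : L2 F -> L2 G -> L2 K -> inner (F + G) K = inner F K + inner G K.
Proof. by move=> HF HG HK; rewrite -[F]scale1r inner_linl// scale1r mul1r. Qed.

Lemma inner0l K : inner 0 K = 0.
Proof.
rewrite /Defs.inner -[RHS](mul0r (fine (leb d Omega))) -Rintegral_cst//.
apply: eq_Rintegral => x _; apply: big1 => i _; apply: big1 => j _.
by rewrite mxE mul0r.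
Qed.

Lemma innerZl (a : R) F K : L2 F -> L2 K -> inner (a *: F) K = a * inner F K.
Proof.
by move=> HF HK; rewrite -[_ *: _]addr0 inner_linl ?inner0l ?addr0//; exact: L2_0.
Qed.

Lemma innerBl F G K : L2 F -> L2 G -> L2 K -> inner (F - G) K = inner F K - inner G K.
Proof.
by move=> HF HG HK; rewrite addrC -scaleN1r inner_linl// mulN1r addrC.
Qed.

Lemma inner_ae F F' G G' : L2 F -> L2 F' -> L2 G -> L2 G' ->
  ae (fun x => F x = F' x) -> ae (fun x => G x = G' x) ->
  inner F G = inner F' G'.
Proof.
move=> HF HF' HG HG' eF eG; apply: ae_eq_Rintegral => //.
- exact/rint_measurable/inner_rint.
- exact/rint_measurable/inner_rint.
- by apply: filterS2 eF eG => x eFx eGx Ox; rewrite eFx// eGx.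
Qed.

Lemma inner_ge0 F : 0 <= inner F F.
Proof.
apply: Rintegral_ge0 => x _; apply: sumr_ge0 => i _; apply: sumr_ge0 => j _.
by rewrite -expr2 sqr_ge0.
Qed.

Lemma nrm_ge0 F : 0 <= nrm F. Proof. exact: sqrtr_ge0. Qed.

Lemma nrm_sqr F : nrm F ^+ 2 = inner F F.
Proof. by rewrite sqr_sqrtr// inner_ge0. Qed.

Lemma nrm_ae F F' : L2 F -> L2 F' -> ae (fun x => F x = F' x) -> nrm F = nrm F'.
Proof. by move=> HF HF' FF'; rewrite /Defs.nrm (inner_ae HF HF' HF HF'). Qed.

Lemma innerDr F G K : L2 F -> L2 G -> L2 K -> inner K (F + G) = inner K F + inner K G.
Proof. by move=> HF HG HK; rewrite !(innerC K) innerDl. Qed.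

Lemma inner_sqrD F G : L2 F -> L2 G ->
  inner (F + G) (F + G) = inner F F + 2 * inner F G + inner G G.
Proof.
move=> HF HG; rewrite innerDl//; last exact: L2D.
rewrite !innerDr// (innerC G F); ring.
Qed.

Lemma innerZZ (t s : R) F G : L2 F -> L2 G ->
  inner (t *: F) (s *: G) = t * s * inner F G.
Proof.
move=> HF HG; rewrite innerZl//; last exact: L2Z.
by rewrite innerC innerZl// innerC mulrA.
Qed.

Lemma cauchy_schwarz F G : L2 F -> L2 G -> `|inner F G| <= nrm F * nrm G.
Proof.
move=> HF HG; rewrite -ler_sqr ?nnegrE ?mulr_ge0 ?nrm_ge0//.
rewrite exprMn !nrm_sqr real_normK ?num_real//.
set a := inner F F; set b := inner F G; set c := inner G G.
have E (t s : R) : 0 <= t ^+ 2 * a + 2 * t * s * b + s ^+ 2 * c.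
  have Lt := L2Z t HF; have Ls := L2Z s HG.
  have := inner_ge0 (t *: F + s *: G).
  rewrite inner_sqrD// !innerZZ// -/a -/b -/c.
  suff -> : t * t * a + 2 * (t * s * b) + s * s * c =
    t ^+ 2 * a + 2 * t * s * b + s ^+ 2 * c by [].
  ring.
exact: (quadratic_form_ge0 (inner_ge0 G) E).
Qed.

Lemma nrmZ (a : R) F : L2 F -> nrm (a *: F) = `|a| * nrm F.
Proof.
move=> HF; rewrite /Defs.nrm innerZZ// -expr2 sqrtrM ?sqr_ge0//.
by rewrite sqrtr_sqr.
Qed.

Lemma nrmN F : L2 F -> nrm (- F) = nrm F.
Proof. by move=> HF; rewrite -scaleN1r nrmZ// normrN1 mul1r. Qed.

Lemma nrmD F G : L2 F -> L2 G -> nrm (F + G) <= nrm F + nrm G.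
Proof.
move=> HF HG; rewrite -ler_sqr ?nnegrE ?addr_ge0 ?nrm_ge0//.
rewrite sqrrD !nrm_sqr inner_sqrD//.
by have := le_trans (ler_norm _) (cauchy_schwarz HF HG); lra.
Qed.

Lemma nrm0 : nrm (0 : 'rV[R]_d -> 'M[R]_(m, n)) = 0.
Proof. by rewrite /Defs.nrm inner0l sqrtr0. Qed.

Lemma nrm_eq0 F : L2 F -> nrm F = 0 -> ae (fun x => F x = 0).
Proof.
move=> HF /eqP; rewrite -sqrf_eq0 nrm_sqr => /eqP F0.
have /integrableP[mF _] := inner_rint HF HF.
have fF x : 0 <= \sum_i \sum_j F x i j * F x i j.
  by apply: sumr_ge0 => i _; apply: sumr_ge0 => j _; rewrite -expr2 sqr_ge0.
have : (\int[leb d]_(x in Omega)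
    `|(EFin \o (fun x => \sum_i \sum_j (F x i j * F x i j)%R)%R) x| = 0)%E.
  rewrite -[RHS](_ : (inner F F)%:E = 0%E); last by rewrite F0.
  rewrite /Defs.inner /Rintegral fineK; last first.
    exact: integrable_fin_num (inner_rint HF HF).
  by apply: eq_integral => x _; rewrite /= ger0_norm.
move=> /(ae_eq_integral_abs _ mO mF); apply: filterS => x /[apply] -[].
move=> /eqP; rewrite psumr_eq0 => [/allP Hs|i _]; last first.
  by apply: sumr_ge0 => j _; rewrite -expr2 sqr_ge0.
apply/matrixP => i j; rewrite mxE.
have := Hs i (mem_index_enum _); rewrite psumr_eq0 => [/allP Hj|k _].
  by have := Hj j (mem_index_enum _); rewrite mulf_eq0 orbb => /eqP.
by rewrite -expr2 sqr_ge0.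
Qed.

End L2_space.

(** * The space of zero-trace Sobolev fields *)

(** The form in which limits are used below: a fixed quantity dominated by a
    null sequence is nonpositive. *)
Lemma le0_of_cvg0 (R : realType) (c C : R) (s : nat -> R) :
  (forall k, c <= C * s k) -> s k @[k --> \oo] --> (0 : R) -> c <= 0.
Proof.
move=> cs s0.
have Cs : (C * s k) @[k --> \oo] --> (0 : R).
  by rewrite -[X in _ --> X](mulr0 C); apply: cvgM => //; exact: cvg_cst.
have <- : lim ((C * s k) @[k --> \oo]) = 0 by exact: cvg_lim Cs.
by apply: limr_ge; [exact: cvgP Cs|exact: nearW].
Qed.

Section sobolev.
Context {R : realType} {d : nat} (Omega : set 'rV[R]_d).
Hypothesis mO : measurable Omega.
Local Notation field := ('rV[R]_d -> 'rV[R]_d).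
Local Notation tensor := ('rV[R]_d -> 'M[R]_d).
Local Notation ae P := {ae leb d, forall x, Omega x -> P x}.
Local Notation L2 := (L2 Omega).
Local Notation inner := (inner Omega).
Local Notation nrm := (nrm Omega).
Local Notation H10 := (H10_with_grad Omega).
Implicit Types (u v w phi psi : field) (G K : tensor).

Lemma test_sq_int f : test_function Omega f -> sq_int (leb d) Omega f.
Proof.
move=> tf; split; first exact: test_measurable.
exact: (test_integrable mO (testM tf tf)).
Qed.

Lemma test_field_L2 phi : test_field Omega phi -> L2 phi.
Proof. by move=> tp i j; rewrite ord1; exact: test_sq_int. Qed.

Lemma classical_grad_L2 phi : test_field Omega phi -> L2 (classical_grad phi).
Proof.
move=> tp i j.
suff : sq_int (leb d) Omega (fun x => classical_grad phi x i j) by [].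
rewrite (_ : (fun x => _) = partial i (fun y => phi y 0 j)); last first.
  by apply/funext => x; rewrite mxE.
exact/test_sq_int/test_partial.
Qed.

Lemma field_lin_coord (a : R) phi psi j :
  (fun x => (a *: phi + psi) x 0 j) =
  a *: (fun x => phi x 0 j) + (fun x => psi x 0 j).
Proof. by apply/funext => x; rewrite !fctE !mxE. Qed.

Lemma test_field_lin (a : R) phi psi :
  test_field Omega phi -> test_field Omega psi ->
  test_field Omega (a *: phi + psi).
Proof.
move=> tp tq j; rewrite field_lin_coord.
by apply: testD; [exact: testZ|exact: tq].
Qed.

Lemma classical_grad_lin (a : R) phi psi :
  test_field Omega phi -> test_field Omega psi ->
  classical_grad (a *: phi + psi) = a *: classical_grad phi + classical_grad psi.
Proof.
move=> tp tq; apply/funext => x; apply/matrixP => i j.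
rewrite !fctE !mxE field_lin_coord.
rewrite partialD ?partialZ => // [y|y|y].
- exact: test_derivable.
- by apply: derivableZ; exact: test_derivable.
- exact: test_derivable.
Qed.

Lemma weak_grad_lin (a : R) u v G K : L2 u -> L2 v -> L2 G -> L2 K ->
  weak_grad Omega u G -> weak_grad Omega v K ->
  weak_grad Omega (a *: u + v) (a *: G + K).
Proof.
move=> Lu Lv LG LK wu wv i j psi tpsi.
have Ip (f : 'rV[R]_d -> R) g : sq_int (leb d) Omega f -> test_function Omega g ->
    rint (leb d) Omega (fun x => f x * g x).
  by move=> sf /test_sq_int; exact: sq_intM.
have tp := test_partial i tpsi.
have E1 : \int[leb d]_(x in Omega) ((a *: u + v) x 0 j * partial i psi x) =
    a * \int[leb d]_(x in Omega) (u x 0 j * partial i psi x) +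
    \int[leb d]_(x in Omega) (v x 0 j * partial i psi x).
  rewrite -RintegralZl//; last exact: Ip (Lu 0 j) tp.
  rewrite -RintegralD//; [|exact/rintZ/(Ip _ _ (Lu 0 j) tp)|exact: Ip (Lv 0 j) tp].
  by apply: eq_Rintegral => x _; rewrite !fctE !mxE mulrDl mulrA.
have E2 : \int[leb d]_(x in Omega) ((a *: G + K) x i j * psi x) =
    a * \int[leb d]_(x in Omega) (G x i j * psi x) +
    \int[leb d]_(x in Omega) (K x i j * psi x).
  rewrite -RintegralZl//; last exact: Ip (LG i j) tpsi.
  rewrite -RintegralD//; [|exact/rintZ/(Ip _ _ (LG i j) tpsi)|exact: Ip (LK i j) tpsi].
  by apply: eq_Rintegral => x _; rewrite !fctE !mxE mulrDl mulrA.
by rewrite E1 E2 wu// wv// opprD mulrN.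
Qed.

Lemma cvg_nrm_lin m n (a : R) (F G : 'rV[R]_d -> 'M[R]_(m, n))
    (Fk Gk : nat -> 'rV[R]_d -> 'M[R]_(m, n)) :
  (forall k, L2 (Fk k)) -> (forall k, L2 (Gk k)) -> L2 F -> L2 G ->
  nrm (Fk k - F) @[k --> \oo] --> (0 : R) ->
  nrm (Gk k - G) @[k --> \oo] --> (0 : R) ->
  nrm (a *: Fk k + Gk k - (a *: F + G)) @[k --> \oo] --> (0 : R).
Proof.
move=> LFk LGk LF LG cF cG.
have H : (`|a| * nrm (Fk k - F) + nrm (Gk k - G)) @[k --> \oo] --> (0 : R).
  rewrite -[X in _ --> X]addr0 -[X in _ --> X + _](mulr0 `|a|).
  by apply: cvgD => //; apply: cvgM => //; exact: cvg_cst.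
apply: (squeeze_cvgr _ (cvg_cst 0) H); apply: nearW => k.
rewrite nrm_ge0 /=.
rewrite (_ : _ - _ = a *: (Fk k - F) + (Gk k - G)); last first.
  by rewrite scalerBr opprD addrACA.
have LdF := L2B mO (LFk k) LF; have LdG := L2B mO (LGk k) LG.
by rewrite (le_trans (nrmD mO (L2Z mO a LdF) LdG))// nrmZ.
Qed.

Lemma H10_lin (a : R) u v G K : H10 u G -> H10 v K ->
  H10 (a *: u + v) (a *: G + K).
Proof.
move=> [Lu LG wu [p [tp pu pG]]] [Lv LK wv [q [tq qv qK]]]; split.
- exact: L2_lin.
- exact: L2_lin.
- exact: weak_grad_lin.
exists (fun k => a *: p k + q k); split.
- by move=> k; exact: test_field_lin.
- by apply: cvg_nrm_lin => // k; exact: test_field_L2.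
- under eq_fun do rewrite classical_grad_lin//.
  by apply: cvg_nrm_lin => // k; exact: classical_grad_L2.
Qed.

(** The constant sequence approximates [phi]; that its classical gradient is also
    a weak one is integration by parts. *)
Lemma H10_test phi : test_field Omega phi -> H10 phi (classical_grad phi).
Proof.
move=> tp; split.
- exact: test_field_L2.
- exact: classical_grad_L2.
- move=> i j psi tpsi; rewrite test_by_parts//.
  by congr (- _); apply: eq_Rintegral => x _; rewrite mxE.
exists (fun=> phi); split => //.
  by rewrite subrr nrm0//; exact: cvg_cst.
by rewrite subrr nrm0//; exact: cvg_cst.
Qed.

(** Gradients of test fields have test functions as entries, so a weak gradient
    can be tested against them. *)
Lemma weak_grad_inner u G psi : L2 G -> weak_grad Omega u G ->
  (forall i j, test_function Omega (fun x => classical_grad psi x i j)) ->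
  inner G (classical_grad psi) =
  - \sum_i \sum_j \int[leb d]_(x in Omega)
      (u x 0 j * partial i (fun x => classical_grad psi x i j) x).
Proof.
move=> LG wu tpsi.
have I i j : rint (leb d) Omega (fun x => G x i j * classical_grad psi x i j).
  by apply: sq_intM => //; exact: test_sq_int.
rewrite /Defs.inner Rintegral_sum//; last by move=> i; exact: rint_sum.
rewrite -sumrN; apply: eq_bigr => i _.
rewrite Rintegral_sum// -sumrN; apply: eq_bigr => j _.
by rewrite wu// opprK.
Qed.

(** The difference [D] of two gradients of [u] is a weak gradient of 0, hence is
    orthogonal to all gradients of test fields; but it is also an L^2 limit of
    such gradients, hence orthogonal to itself. *)
Lemma H10_grad_uniq u G K : H10 u G -> H10 u K -> ae (fun x => G x = K x).
Proof.
move=> HG HK; have [Lu LG wG _] := HG; have [_ LK wK _] := HK.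
have := H10_lin (-1) HK HG; rewrite !scaleN1r ![- _ + _]addrC subrr.
move=> [_ LD w0 [p [tp _ pD]]].
set D := G - K in LD w0 pD *.
have D0 k : inner D (classical_grad (p k)) = 0.
  have tc i j : test_function Omega (fun x => classical_grad (p k) x i j).
    rewrite (_ : (fun x => _) = partial i (fun y => p k y 0 j)).
      exact: (test_partial i (tp k j)).
    by apply/funext => x; rewrite mxE.
  rewrite (weak_grad_inner LD w0)// big1 ?oppr0// => i _; rewrite big1// => j _.
  rewrite -[RHS](mul0r (fine (leb d Omega))) -Rintegral_cst//.
  by apply: eq_Rintegral => x _; rewrite mxE mul0r.
have D_le0 : inner D D <= 0.
  apply: (@le0_of_cvg0 _ _ (nrm D) _ _ pD) => k.
  have Lc := classical_grad_L2 (tp k).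
  have -> : inner D D = - inner D (classical_grad (p k) - D).
    by rewrite [in RHS]innerC innerBl// (innerC _ (classical_grad _) D) D0 sub0r opprK.
  rewrite (le_trans (ler_norm _))// normrN.
  by apply: cauchy_schwarz => //; exact: L2B.
have nD0 : nrm D = 0.
  by rewrite /Defs.nrm (_ : inner D D = 0) ?sqrtr0//;
     apply/eqP; rewrite eq_le D_le0 inner_ge0.
have := nrm_eq0 mO LD nD0; apply: filterS => x /[apply] Dx.
by apply/eqP; rewrite -subr_eq0; apply/eqP.
Qed.

Lemma gradP u : X Omega u -> H10 u (grad Omega u).
Proof. by move=> Xu; exact: xgetPex. Qed.

Lemma X_L2 u : X Omega u -> L2 u. Proof. by move=> /gradP[]. Qed.

Lemma grad_L2 u : X Omega u -> L2 (grad Omega u). Proof. by move=> /gradP[]. Qed.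

Lemma X_lin (a : R) u v : X Omega u -> X Omega v -> X Omega (a *: u + v).
Proof. by move=> [G HG] [K HK]; exists (a *: G + K); exact: H10_lin. Qed.

Lemma X_test phi : test_field Omega phi -> X Omega phi.
Proof. by move=> /H10_test; exists (classical_grad phi). Qed.

Lemma X0 : X Omega 0.
Proof.
apply: X_test => j; rewrite (_ : (fun x => _) = 0); first exact: test0.
by apply/funext => x; rewrite mxE.
Qed.

Lemma XZ (a : R) u : X Omega u -> X Omega (a *: u).
Proof. by move=> Xu; rewrite -[_ *: _]addr0; apply: X_lin => //; exact: X0. Qed.

Lemma XB u v : X Omega u -> X Omega v -> X Omega (u - v).
Proof. by move=> Xu Xv; rewrite addrC -scaleN1r; exact: X_lin. Qed.

Lemma grad_lin (a : R) u v : X Omega u -> X Omega v ->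
  ae (fun x => grad Omega (a *: u + v) x = a *: grad Omega u x + grad Omega v x).
Proof.
move=> Xu Xv; apply: (@H10_grad_uniq _ _ (a *: grad Omega u + grad Omega v)).
  exact/gradP/X_lin.
by apply: H10_lin; exact: gradP.
Qed.

Lemma grad_test phi : test_field Omega phi ->
  ae (fun x => grad Omega phi x = classical_grad phi x).
Proof. by move=> tp; apply: H10_grad_uniq (H10_test tp); exact/gradP/X_test. Qed.

End sobolev.

(** * The trilinear form *)

(** Turns a one-sided bound into a two-sided one for a quantity that is odd in
    one of its arguments; [`|M|] appears because the sign of [M] is unknown. *)
Lemma norm_le_of_opp (R : realType) (M x x' y z t t' : R) :
  0 <= x -> 0 <= y -> 0 <= z -> t' = - t -> x' = x ->
  t <= M * x * y * z -> t' <= M * x' * y * z -> `|t| <= `|M| * x * y * z.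
Proof.
move=> x0 y0 z0 -> -> H Hn.
have C : M * x * y * z <= `|M| * x * y * z.
  by rewrite !ler_wpM2r// ler_norm.
by rewrite ler_norml lerNl !(le_trans _ C).
Qed.

(** A bounded bilinear form that vanishes on the diagonal of a dense set does so
    everywhere: in the expansion of [B w w] around [B (p k) (p k) = 0] each term
    has [p k - w] as an argument. *)
Lemma diag_eq0_of_dense (R : realType) (E : zmodType) (X : set E) (N : E -> R)
    (B : E -> E -> R) (C : R) (p : nat -> E) (w : E) :
  (forall x y, X x -> X y -> X (x - y)) ->
  (forall x y z, X x -> X y -> X z -> B (x - y) z = B x z - B y z) ->
  (forall x y z, X x -> X y -> X z -> B x (y - z) = B x y - B x z) ->
  (forall x y, X x -> X y -> `|B x y| <= C * N x * N y) ->
  X w -> (forall k, X (p k)) -> N (p k - w) @[k --> \oo] --> (0 : R) ->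
  (forall k, B (p k) (p k) = 0) -> B w w = 0.
Proof.
move=> XB BBl BBr BC Xw Xp pw Bp; apply/eqP; rewrite -normr_eq0 eq_le normr_ge0 andbT.
have s0 : (N (p k - w) * (2 * N w + N (p k - w))) @[k --> \oo] --> (0 : R).
  rewrite -[X in _ --> X](mul0r (2 * N w + 0)); apply: cvgM => //.
  by apply: cvgD => //; exact: cvg_cst.
apply: (@le0_of_cvg0 _ _ C _ _ s0) => k; have Xe := XB _ _ (Xp k) Xw.
have -> : B w w = - B (p k - w) w - B w (p k - w) - B (p k - w) (p k - w).
  rewrite !(BBl, BBr)// Bp; ring.
have := BC _ _ Xe Xw; have := BC _ _ Xw Xe; have := BC _ _ Xe Xe.
move: (B _ _) (B w _) (B _ w) (N (p k - w)) (N w) => b1 b2 b3 n1 n2 H1 H2 H3.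
apply: (@le_trans _ _ (`|b3| + `|b2| + `|b1|)).
  by rewrite (le_trans (ler_normB _ _))// lerD2r (le_trans (ler_normB _ _))// normrN.
apply: le_trans (lerD (lerD H3 H2) H1) _.
by rewrite le_eqVlt; apply/orP; left; apply/eqP; ring.
Qed.

Section trilinear.
Context {R : realType} {d : nat} (Omega : set 'rV[R]_d).
Hypothesis mO : measurable Omega.
Hypothesis hb : b_defined Omega.
Variable M : R.
Hypothesis hM : b_constant Omega M.
Local Notation field := ('rV[R]_d -> 'rV[R]_d).
Local Notation X := (X Omega).
Local Notation b := (b Omega).
Local Notation nrm := (nrm Omega).
Local Notation grad := (grad Omega).
Implicit Types u v w phi : field.

Lemma b_rint u v w : X u -> X v -> X w ->
  rint (leb d) Omega (fun x => \sum_i \sum_j convect Omega u v x i j * w x i j).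
Proof.
move=> Xu Xv Xw; have := hb Xu Xv Xw.
by rewrite /rint; congr (_.-integrable _ _); apply/funext => x /=; rewrite big_ord1.
Qed.

Lemma b_linl (a : R) u u' v w : X u -> X u' -> X v -> X w ->
  b (a *: u + u') v w = a * b u v w + b u' v w.
Proof.
move=> Xu Xu' Xv Xw; rewrite /Defs.b /inner -RintegralZl//; last exact: b_rint.
rewrite -RintegralD//; [|exact/rintZ/b_rint|exact: b_rint].
apply: eq_Rintegral => x _; rewrite mulr_sumr -big_split; apply: eq_bigr => i _.
rewrite mulr_sumr -big_split; apply: eq_bigr => j _.
rewrite /convect !fctE mulmxDl -scalemxAl.
by rewrite [X in X * _ = _]mxE [X in (X + _) * _ = _]mxE mulrDl mulrA.
Qed.

Lemma b_linm (a : R) u v v' w : X u -> X v -> X v' -> X w ->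
  b u (a *: v + v') w = a * b u v w + b u v' w.
Proof.
move=> Xu Xv Xv' Xw; rewrite /Defs.b /inner -RintegralZl//; last exact: b_rint.
rewrite -RintegralD//; [|exact/rintZ/b_rint|exact: b_rint].
apply: ae_eq_Rintegral => //.
- exact: rint_measurable (b_rint Xu (X_lin mO a Xv Xv') Xw).
- apply: rint_measurable.
  exact: (rintD mO (rintZ mO a (b_rint Xu Xv Xw)) (b_rint Xu Xv' Xw)).
apply: filterS (grad_lin mO a Xv Xv') => x H Ox.
rewrite mulr_sumr -big_split; apply: eq_bigr => i _.
rewrite mulr_sumr -big_split; apply: eq_bigr => j _.
rewrite /convect H// mulmxDr -scalemxAr.
by rewrite [X in X * _ = _]mxE [X in (X + _) * _ = _]mxE mulrDl mulrA.
Qed.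

Lemma b_linr (a : R) u v w w' : X u -> X v -> X w -> X w' ->
  b u v (a *: w + w') = a * b u v w + b u v w'.
Proof.
move=> Xu Xv Xw Xw'; rewrite /Defs.b /inner -RintegralZl//; last exact: b_rint.
rewrite -RintegralD//; [|exact/rintZ/b_rint|exact: b_rint].
apply: eq_Rintegral => x _; rewrite mulr_sumr -big_split; apply: eq_bigr => i _.
rewrite mulr_sumr -big_split; apply: eq_bigr => j _.
by rewrite !fctE !mxE mulrDr mulrCA.
Qed.

Lemma bBl u u' v w : X u -> X u' -> X v -> X w -> b (u - u') v w = b u v w - b u' v w.
Proof. by move=> *; rewrite addrC -scaleN1r b_linl// mulN1r addrC. Qed.

Lemma bBm u v v' w : X u -> X v -> X v' -> X w -> b u (v - v') w = b u v w - b u v' w.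
Proof. by move=> *; rewrite addrC -scaleN1r b_linm// mulN1r addrC. Qed.

Lemma bBr u v w w' : X u -> X v -> X w -> X w' -> b u v (w - w') = b u v w - b u v w'.
Proof. by move=> *; rewrite addrC -scaleN1r b_linr// mulN1r addrC. Qed.

Lemma bNl u v w : X u -> X v -> X w -> b (- u) v w = - b u v w.
Proof.
move=> Xu Xv Xw; have X0' := @X0 _ _ Omega mO.
have := b_linl (-1) Xu X0' Xv Xw; have := bBl X0' X0' Xv Xw.
by rewrite !subrr => ->; rewrite scaleN1r mulN1r !addr0.
Qed.

Lemma nrm_gradN u : X u -> nrm (grad (- u)) = nrm (grad u).
Proof.
move=> Xu; have Xn : X (- u) by rewrite -scaleN1r; exact: XZ.
apply: etrans (nrmN mO (grad_L2 Xu)); apply: nrm_ae => //; first exact: grad_L2.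
  by rewrite -scaleN1r; apply: L2Z => //; exact: grad_L2.
have Nu : -1 *: u + 0 = - u by rewrite scaleN1r addr0.
have N0 : -1 *: (0 : field) + 0 = 0 by rewrite scaler0 addr0.
have := grad_lin mO (-1) Xu (X0 mO); have := grad_lin mO (-1) (X0 mO) (X0 mO).
rewrite Nu N0; apply: filterS2 => x E1 E2 Ox; rewrite E2// E1//.
have -> : (- grad u) x = - grad u x by [].
move: (grad u x) (grad 0 x) => A B.
rewrite !scaleN1r.
rewrite (addNr B).
by rewrite addr0.
Qed.

Lemma norm_b_le u v w : X u -> X v -> X w ->
  `|b u v w| <= `|M| * nrm (grad u) * nrm (grad v) * nrm (grad w).
Proof.
move=> Xu Xv Xw; have Xn : X (- u) by rewrite -scaleN1r; exact: XZ.
have [_ H _] := hM Xu Xv Xw; have [_ Hn _] := hM Xn Xv Xw.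
exact: (norm_le_of_opp (nrm_ge0 _ _) (nrm_ge0 _ _) (nrm_ge0 _ _)
          (bNl Xu Xv Xw) (nrm_gradN Xu) H Hn).
Qed.

Lemma norm_b_le_interp u v w : X u -> X v -> X w ->
  `|b u v w| <= `|M| * Num.sqrt (nrm u) * Num.sqrt (nrm (grad u)) *
                nrm (grad v) * nrm (grad w).
Proof.
move=> Xu Xv Xw; have Xn : X (- u) by rewrite -scaleN1r; exact: XZ.
have [H _ _] := hM Xu Xv Xw; have [Hn _ _] := hM Xn Xv Xw.
rewrite -(mulrA `|M|); rewrite -(mulrA M) in H; rewrite -(mulrA M) in Hn.
apply: (norm_le_of_opp _ (nrm_ge0 _ _) (nrm_ge0 _ _) (bNl Xu Xv Xw) _ H Hn).
  by rewrite mulr_ge0 ?sqrtr_ge0.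
exact: (congr2 (fun x y => Num.sqrt x * Num.sqrt y)
          (nrmN mO (X_L2 Xu)) (nrm_gradN Xu)).
Qed.

(** The integrand is half the sum of the [v_k * partial k (phi_j ^+ 2)], and
    [phi_j ^+ 2] may serve as a test function for the weak gradient of [v], whose
    trace vanishes. *)
Lemma b_test_eq0 v phi : V Omega v -> test_field Omega phi -> b v phi phi = 0.
Proof.
move=> [Xv divv] tp.
have tf (j : 'I_d) : test_function Omega (fun x => phi x 0 j) by exact: tp.
pose q (j : 'I_d) : 'rV[R]_d -> R := (fun x => phi x 0 j) * (fun x => phi x 0 j).
have tq j : test_function Omega (q j) by exact: testM.
have Lv : forall k, sq_int (leb d) Omega (fun x => v x 0 k) by exact: X_L2 Xv 0.
have Lg : forall k j, sq_int (leb d) Omega (fun x => grad v x k j) by exact: grad_L2 Xv.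
have Iv k j : rint (leb d) Omega (fun x => v x 0 k * partial k (q j) x).
  by apply: sq_intM => //; exact/test_sq_int/test_partial.
have Ig k j : rint (leb d) Omega (fun x => grad v x k k * q j x).
  by apply: sq_intM => //; exact/test_sq_int.
have [_ _ wv _] := gradP Xv.
have Xp := X_test mO tp.
have E1 : b v phi phi = \int[leb d]_(x in Omega)
    (2^-1 * \sum_j \sum_k (v x 0 k * partial k (q j) x)).
  apply: ae_eq_Rintegral => //.
  - exact: rint_measurable (b_rint Xv Xp Xp).
  - apply: rint_measurable; apply: (rintZ mO).
    by apply: (rint_sum mO) => j; exact: (rint_sum mO).
  apply: filterS (grad_test mO tp) => x Hx Ox.
  rewrite big_ord1 mulr_sumr; apply: eq_bigr => j _.
  rewrite /convect Hx// mxE mulr_suml mulr_sumr; apply: eq_bigr => k _.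
  rewrite mxE /q partialM => [|y|y]; try exact: test_derivable.
  by rewrite !fctE; field.
rewrite E1 RintegralZl//; last by apply: (rint_sum mO) => j; exact: (rint_sum mO).
rewrite Rintegral_sum//; last by move=> j; exact: (rint_sum mO).
rewrite big1 ?mulr0// => j _; rewrite Rintegral_sum//.
under eq_bigr do rewrite wv//.
rewrite sumrN -Rintegral_sum//.
apply/eqP; rewrite oppr_eq0; apply/eqP.
rewrite -[RHS](mul0r (fine (leb d Omega))) -Rintegral_cst//.
apply: ae_eq_Rintegral => //.
- by apply: rint_measurable; exact: (rint_sum mO).
apply: filterS divv => x Hx Ox; rewrite -mulr_suml.
by have := Hx Ox; rewrite /mxtrace => ->; rewrite mul0r.
Qed.

Lemma b_skew_eq0 v w : V Omega v -> X w -> b v w w = 0.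
Proof.
move=> Vv Xw; have [Xv _] := Vv.
have [Lw Lg _ [p [tp _ pG]]] := gradP Xw.
have Xp k : X (p k) by exact: (X_test mO (tp k)).
have nG k : nrm (classical_grad (p k) - grad w) = nrm (grad (p k - w)).
  apply: (nrm_ae mO (L2B mO (classical_grad_L2 mO (tp k)) Lg)
            (grad_L2 (XB mO (Xp k) Xw))).
  have E0 : -1 *: w + p k = p k - w by rewrite scaleN1r addrC.
  have := grad_lin mO (-1) Xw (Xp k); rewrite E0.
  apply: filterS2 (grad_test mO (tp k)) => x E1 E2 Ox.
  rewrite (E2 Ox) (E1 Ox) scaleN1r [RHS]addrC.
  by [].
have NG : nrm (grad (p k - w)) @[k --> \oo] --> (0 : R).
  by move: pG; under eq_fun do rewrite nG.
exact: (@diag_eq0_of_dense _ _ X (fun u => nrm (grad u)) (b v)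
    (`|M| * nrm (grad v)) p w (@XB _ _ _ mO)
    (fun x y z Xx Xy Xz => bBm Xv Xx Xy Xz) (fun x y z Xx Xy Xz => bBr Xv Xx Xy Xz)
    (fun x y Xx Xy => norm_b_le Xv Xx Xy) Xw Xp NG
    (fun k => b_test_eq0 Vv (tp k))).
Qed.

End trilinear.

(** * Real estimates *)

Ltac solve_ge0 := repeat first
  [ done | exact: sqr_ge0 | exact: sqrtr_ge0 | by apply: ltW
  | apply: exprn_ge0 | apply: divr_ge0 | apply: mulr_ge0 | apply: addr_ge0 ].

Section real_estimates.
Context {R : realType}.
Implicit Types a g x y p : R.

(** Young's inequality for the exponents 4/3 and 4. The constant 54 makes
    [y = 6 * p] a double root of the difference, whence the factorization. *)
Lemma young_quartic p y : p * y ^+ 3 <= y ^+ 4 / 8 + 54 * p ^+ 4.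
Proof.
rewrite -subr_ge0 [X in 0 <= X](_ : _ = (y - 6 * p) ^+ 2 *
  ((y + 2 * p) ^+ 2 / 8 + p ^+ 2)); last by field.
by rewrite mulr_ge0 ?sqr_ge0// addr_ge0 ?sqr_ge0// divr_ge0 ?sqr_ge0.
Qed.

Lemma powR_three_halves (x : R) : 0 <= x -> x `^ (3 / 2) = Num.sqrt x ^+ 3.
Proof.
move=> x0; rewrite -powR12_sqrt// -powR_mulrn ?powR_ge0// -powRrM.
by congr (_ `^ _); field.
Qed.

(** Put [Q = CI * H * M ^+ 2 * nf ^+ 2]. The first condition bounds [Q] by a
    multiple of [hnu ^+ 4], as [Cv] is at least [nf / hnu]; the second one bounds
    it by a multiple of [nu ^+ (5/2) * hnu ^+ (3/2)]. The former is the stronger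
    one for large [nu / hnu], the latter for small [nu / hnu]. *)
Lemma smallness (nu hnu H CI M nf Cv : R) :
  0 < nu -> 0 < hnu -> 0 < H -> 0 < CI -> nf ^+ 2 <= hnu ^+ 2 * Cv ^+ 2 ->
  H * (Num.sqrt 27 * CI * M ^+ 2 * Cv ^+ 2) <= Num.sqrt 2 * hnu ^+ 2 ->
  H * (46 * CI * nu `^ (3 / 2) * hnu `^ (- (3 / 2)) *
       (M * nu ^- 2 * nf) ^+ 2) < 1 ->
  18 * (CI * H * M ^+ 2 * nf ^+ 2) <= nu ^+ 2 * hnu ^+ 2.
Proof.
move=> nu0 hnu0 H0 CI0 nfCv h1 h3.
set Q := CI * H * M ^+ 2 * nf ^+ 2.
have Q0 : 0 <= Q by rewrite /Q; solve_ge0.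
have h4 : 0 < hnu ^+ 4 by rewrite exprn_gt0.
have h2 : 0 < hnu ^+ 2 by rewrite exprn_gt0.
have s2 : Num.sqrt 2 <= (3 / 2 : R).
  by rewrite -[leRHS]ger0_norm ?divr_ge0// -sqrtr_sqr ler_sqrt ?exprn_ge0 ?divr_ge0//; lra.
have s27 : (5 : R) <= Num.sqrt 27.
  by rewrite -[leLHS]ger0_norm// -sqrtr_sqr ler_sqrt//; lra.
have Q1 : 5 * Q <= 3 / 2 * hnu ^+ 4.
  pose P := H * CI * M ^+ 2 * Cv ^+ 2.
  have P0 : 0 <= P by rewrite /P; solve_ge0.
  have QP : Q <= hnu ^+ 2 * P.
    rewrite /Q /P [leRHS](_ : _ = CI * H * M ^+ 2 * (hnu ^+ 2 * Cv ^+ 2)); last by ring.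
    by apply: ler_wpM2l => //; solve_ge0.
  have h1' : Num.sqrt 27 * P <= Num.sqrt 2 * hnu ^+ 2.
    by move: h1; congr (_ <= _); rewrite /P; ring.
  have PP : 5 * P <= 3 / 2 * hnu ^+ 2.
    apply: le_trans (ler_wpM2r P0 s27) _; apply: le_trans h1' _.
    by apply: ler_wpM2r => //; solve_ge0.
  apply: (@le_trans _ _ (5 * (hnu ^+ 2 * P))); first by apply: ler_wpM2l.
  rewrite mulrCA.
  rewrite [leRHS](_ : _ = hnu ^+ 2 * (3 / 2 * hnu ^+ 2)); last by field.
  by apply: ler_wpM2l => //; solve_ge0.
set s := Num.sqrt nu in h3 *; set t := Num.sqrt hnu.
have s0 : 0 < s by rewrite sqrtr_gt0.
have t0 : 0 < t by rewrite sqrtr_gt0.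
have nuE : nu = s ^+ 2 by rewrite sqr_sqrtr// ltW.
have hnuE : hnu = t ^+ 2 by rewrite sqr_sqrtr// ltW.
have Q3 : 46 * Q < s ^+ 5 * t ^+ 3.
  move: h3; rewrite powRN !powR_three_halves ?ltW// -/s -/t.
  rewrite [X in X < 1](_ : _ = 46 * Q / (s ^+ 5 * t ^+ 3)).
    by rewrite ltr_pdivrMr ?mul1r// mulr_gt0 ?exprn_gt0.
  rewrite /Q nuE; field.
  by rewrite !gt_eqF.
(* This compares nu with 4 * hnu; both conditions leave room at this ratio. *)
have [st|st] := leP s (2 * t).
  have : s ^+ 5 * t ^+ 3 <= 2 * (nu ^+ 2 * hnu ^+ 2).
    rewrite nuE hnuE [leLHS](_ : _ = s ^+ 4 * t ^+ 3 * s); last by ring.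
    rewrite [leRHS](_ : _ = s ^+ 4 * t ^+ 3 * (2 * t)); last by ring.
    by apply: ler_wpM2l => //; solve_ge0.
  by lra.
have : 16 * hnu ^+ 4 <= nu ^+ 2 * hnu ^+ 2.
  rewrite nuE hnuE [leLHS](_ : _ = (2 * t) ^+ 4 * t ^+ 4); last by ring.
  rewrite [leRHS](_ : _ = s ^+ 4 * t ^+ 4); last by ring.
  apply: ler_wpM2r; first by solve_ge0.
  by apply: lerXn2r; rewrite ?nnegrE; [solve_ge0|solve_ge0|exact: ltW].
by lra.
Qed.

(** Here [a] and [g] stand for the norms of the error and of its gradient, [gu]
    for the norm of the gradient of the solution and [D] for [`|hnu - nu|].
    Young's inequality costs a quarter of the gradient term and, by the smallness
    condition, a third of the L^2 term of the energy. *)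
Lemma error_estimate (nu hnu H CI m nf gu a g D : R) :
  0 < nu -> 0 < hnu -> 0 < H -> 0 < CI -> 0 <= m -> 0 <= nf ->
  0 <= gu -> 0 <= a -> 0 <= g -> 0 <= D ->
  nu * gu <= nf ->
  18 * (CI * H * m ^+ 2 * nf ^+ 2) <= nu ^+ 2 * hnu ^+ 2 ->
  hnu / 2 * g ^+ 2 + hnu / (2 * CI ^+ 2 * H ^+ 2) * a ^+ 2 <=
    D * gu * g + m * Num.sqrt a * Num.sqrt g * gu * g ->
  g <= 2 * Num.sqrt 2 * (D / hnu) * gu /\
  a <= Num.sqrt 2 * CI * H * (D / (hnu * nu)) * nf.
Proof.
move=> nu0 hnu0 H0 CI0 m0 nf0 gu0 a0 g0 D0 gu_le small energy.
set L := hnu / (2 * CI ^+ 2 * H ^+ 2) in energy *.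
pose x := Num.sqrt a; pose y := Num.sqrt g.
have aE : a = x ^+ 2 by rewrite sqr_sqrtr.
have gE : g = y ^+ 2 by rewrite sqr_sqrtr.
pose q := m * gu.
have q0 : 0 <= q by rewrite mulr_ge0.
have q_small : 18 * (CI * H * q ^+ 2) <= hnu ^+ 2.
  have n2 : 0 < nu ^+ 2 by rewrite exprn_gt0.
  rewrite -(ler_pM2l n2); apply: le_trans small.
  rewrite [leLHS](_ : _ = 18 * (CI * H * m ^+ 2 * (nu * gu) ^+ 2)).
  2: by rewrite /q; ring.
  do 2 (apply: ler_wpM2l; first by solve_ge0).
  by apply: lerXn2r; rewrite ?nnegrE; solve_ge0.
have young : q * x * y ^+ 3 <= hnu / 8 * g ^+ 2 + 54 * q ^+ 4 / hnu ^+ 3 * a ^+ 2.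
  have := ler_wpM2l (ltW hnu0) (young_quartic (q * x / hnu) y).
  rewrite [X in X <= _](_ : _ = q * x * y ^+ 3); last by field; rewrite gt_eqF.
  rewrite [X in _ <= X](_ : _ = hnu / 8 * g ^+ 2 + 54 * q ^+ 4 / hnu ^+ 3 * a ^+ 2)//.
  by rewrite aE gE; field; rewrite gt_eqF.
have absorbed : 54 * q ^+ 4 / hnu ^+ 3 <= L / 3.
  have h3 : 0 < hnu ^+ 3 by rewrite exprn_gt0.
  rewrite ler_pdivrMr// [leRHS](_ : _ = (hnu ^+ 2) ^+ 2 / (6 * (CI * H) ^+ 2)).
    rewrite ler_pdivlMr; last by rewrite mulr_gt0// exprn_gt0// mulr_gt0.
    rewrite [leLHS](_ : _ = (18 * (CI * H * q ^+ 2)) ^+ 2); last by ring.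
    by apply: lerXn2r; rewrite ?nnegrE; solve_ge0.
  by rewrite /L; field; rewrite !gt_eqF.
have core : 3 / 8 * hnu * g ^+ 2 + 2 / 3 * L * a ^+ 2 <= D * gu * g.
  have := ler_wpM2r (sqr_ge0 a) absorbed.
  have E : m * x * y * gu * g = q * x * y ^+ 3 by rewrite gE /q; ring.
  move: energy; rewrite -/x -/y E; lra.
have L0 : 0 < L.
  by rewrite divr_gt0// mulr_gt0 ?exprn_gt0// mulr_gt0 ?exprn_gt0.
split.
  have [->|gn0] := eqVneq g 0.
    by solve_ge0.
  have gp : 0 < g by rewrite lt_def gn0.
  have s2 : (4 / 3 : R) <= Num.sqrt 2.
    by rewrite -[leLHS]ger0_norm ?divr_ge0// -sqrtr_sqr ler_sqrt//; lra.
  have g83 : g <= 8 / 3 * (D / hnu) * gu.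
    rewrite [leRHS](_ : _ = (D * gu) / (3 / 8 * hnu)); last by field; rewrite gt_eqF.
    rewrite ler_pdivlMr; last by rewrite mulr_gt0.
    rewrite -(ler_pM2r gp); apply: le_trans core.
    rewrite [leLHS](_ : _ = 3 / 8 * hnu * g ^+ 2); last by ring.
    by rewrite lerDl; solve_ge0.
  apply: le_trans g83 _; apply: ler_wpM2r => //.
  by apply: ler_wpM2r; [solve_ge0|lra].
pose E := D * nf / nu.
have E0 : 0 <= E by rewrite /E; solve_ge0.
have coreE : 3 / 8 * hnu * g ^+ 2 + 2 / 3 * L * a ^+ 2 <= E * g.
  apply: le_trans core _; rewrite ler_wpM2r// /E -mulrA ler_wpM2l//.
  by rewrite ler_pdivlMr// mulrC.
have La : L * a ^+ 2 <= E ^+ 2 / hnu.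
  (* Completing the square in g. *)
  have sq : 0 <= 3 / 8 * hnu * (g - 4 / 3 * E / hnu) ^+ 2.
    by solve_ge0.
  have E1 : 3 / 8 * hnu * (g - 4 / 3 * E / hnu) ^+ 2 =
      3 / 8 * hnu * g ^+ 2 - E * g + 2 / 3 * (E ^+ 2 / hnu).
    by field; rewrite gt_eqF.
  by rewrite E1 in sq; lra.
rewrite [leRHS](_ : _ = Num.sqrt 2 * (CI * H * E / hnu)); last first.
  by rewrite /E; field; rewrite !gt_eqF.
rewrite -ler_sqr ?nnegrE//; last first.
  by solve_ge0.
rewrite exprMn sqr_sqrtr// -(ler_pM2l L0); apply: le_trans La _.
by rewrite le_eqVlt; apply/orP; left; apply/eqP; rewrite /L; field; rewrite !gt_eqF.
Qed.

Lemma energy_bound (nu hnu lhs rhs ip be c0 c1 c2 : R) :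
  lhs <= rhs -> rhs = (hnu - nu) * ip - be -> `|ip| <= c0 * c1 ->
  `|be| <= c2 -> lhs <= `|hnu - nu| * c0 * c1 + c2.
Proof.
move=> stab energy ip_le be_le; apply: le_trans stab _; rewrite energy.
apply: le_trans (ler_norm _) _; apply: le_trans (ler_normB _ _) _.
by rewrite normrM -mulrA lerD// ler_wpM2l.
Qed.

End real_estimates.

(** * Solutions and the error equation *)

Section dual_norm.
Context {R : realType} {d : nat} (Omega : set 'rV[R]_d).
Variable f : ('rV[R]_d -> 'rV[R]_d) -> R.
Hypothesis hf : dual Omega f.
Local Notation norm_grad phi := (nrm Omega (grad Omega phi)).

Lemma dual_norm_ge0 : 0 <= dual_norm Omega f.
Proof.
rewrite /dual_norm; set E := (X in sup X).
have [Es|/sup_out->//] := pselect (has_sup E); have [[r Er] _] := Es.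
apply: le_trans (sup_upper_bound Es Er); have [phi _ ->] := Er.
by rewrite divr_ge0 ?nrm_ge0.
Qed.

(** If the gradient norm vanishes, [phi] does not enter the supremum, but then
    continuity of [f] forces [f phi = 0]. *)
Lemma dual_le phi : X Omega phi -> `|f phi| <= dual_norm Omega f * norm_grad phi.
Proof.
move=> Xphi; have [_ [C HC]] := hf.
have [p0|pn0] := eqVneq (norm_grad phi) 0.
  by have := HC _ Xphi; rewrite p0 !mulr0.
have pp : 0 < norm_grad phi by rewrite lt_def pn0 nrm_ge0.
rewrite -(ler_pdivrMr _ _ pp); apply: ub_le_sup; last first.
  exact: (ex_intro2 _ _ phi (conj Xphi pn0) erefl).
exists C => _ [psi [Xpsi sn0] ->].
have sp : 0 < norm_grad psi by rewrite lt_def sn0 nrm_ge0.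
by rewrite (ler_pdivrMr _ _ sp); exact: (HC _ Xpsi).
Qed.

End dual_norm.

Section solutions.
Context {R : realType} {d : nat} (Omega : set 'rV[R]_d).
Hypothesis mO : measurable Omega.
Hypothesis hb : b_defined Omega.
Variable M : R.
Hypothesis hM : b_constant Omega M.
Local Notation X := (X Omega).
Local Notation V := (V Omega).
Local Notation b := (b Omega).
Local Notation inner := (inner Omega).
Local Notation nrm := (nrm Omega).
Local Notation grad := (grad Omega).

Lemma gradB u v : X u -> X v ->
  {ae leb d, forall x, Omega x -> grad (u - v) x = (grad u - grad v) x}.
Proof.
move=> Xu Xv; have := grad_lin mO (-1) Xv Xu.
have -> : -1 *: v + u = u - v by rewrite scaleN1r addrC.
apply: filterS => x H Ox; rewrite (H Ox) scaleN1r [LHS]addrC.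
by [].
Qed.

Lemma VB u v : V u -> V v -> V (u - v).
Proof.
move=> [Xu du] [Xv dv]; split; first exact: (XB mO Xu Xv).
have trB (A B : 'M[R]_d) : \tr A = 0 -> \tr B = 0 -> \tr (A - B) = 0.
  by move=> A0 B0; rewrite linearB /= A0 B0 subr0.
apply: filterS3 (gradB Xu Xv) du dv => x H Hu Hv Ox.
by rewrite (H Ox); exact: (trB _ _ (Hu Ox) (Hv Ox)).
Qed.

Lemma inner_gradB u v w : X u -> X v -> X w ->
  inner (grad (u - v)) (grad w) = inner (grad u) (grad w) - inner (grad v) (grad w).
Proof.
move=> Xu Xv Xw; have [Lu Lv Lw] := And3 (grad_L2 Xu) (grad_L2 Xv) (grad_L2 Xw).
rewrite -(innerBl mO Lu Lv Lw).
apply: (inner_ae mO (grad_L2 (XB mO Xu Xv)) (L2B mO Lu Lv) Lw Lw (gradB Xu Xv)).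
exact: aeW.
Qed.

(** Testing the equation with the solution itself removes the convective term. *)
Lemma weak_solution_norm_grad_le f nu u : dual Omega f ->
  NSE_weak_solution Omega nu f u ->
  nu * nrm (grad u) <= dual_norm Omega f.
Proof.
move=> hf [Vu hu]; have [Xu _] := Vu.
have [g0|gn0] := eqVneq (nrm (grad u)) 0.
  by rewrite g0 mulr0 dual_norm_ge0.
have gp : 0 < nrm (grad u) by rewrite lt_def gn0 nrm_ge0.
have := hu _ Vu; rewrite (b_skew_eq0 mO hb hM Vu Xu) addr0 -nrm_sqr => E.
rewrite -(ler_pM2r gp) -mulrA -expr2 E.
exact: le_trans (ler_norm _) (dual_le hf Xu).
Qed.

(** [IH] is linear only almost everywhere, and [IH 0 = 0] must be deduced from
    linearity as well. *)
Lemma interpolation_inner_opp IH H CI u v w :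
  interpolation Omega IH H CI -> X u -> X v -> X w ->
  inner (IH (v - u)) (IH w) = - inner (IH (u - v)) (IH w).
Proof.
move=> [LI lin _ _] Xu Xv Xw.
have Xe := XB mO Xu Xv; have Xe' := XB mO Xv Xu; have X0' := @X0 _ _ Omega mO.
rewrite -mulN1r -(innerZl mO _ (LI _ Xe) (LI _ Xw)).
apply: (inner_ae mO (LI _ Xe') (L2Z mO _ (LI _ Xe)) (LI _ Xw) (LI _ Xw)); last exact: aeW.
have := lin (-1) _ _ Xe X0'; have := lin (-1) _ _ X0' X0'.
have -> : -1 *: (u - v) + 0 = v - u by rewrite addr0 scaleN1r opprB.
have -> : -1 *: (0 : 'rV[R]_d -> 'rV[R]_d) + 0 = 0 by rewrite scaler0 addr0.
apply: filterS2 => x E1 E2 Ox; rewrite (E2 Ox) (E1 Ox) !scaleN1r addNr addr0.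
by [].
Qed.

Lemma error_energy IH H CI f nu hnu mu u v :
  interpolation Omega IH H CI ->
  NSE_weak_solution Omega nu f u -> CDA_solution Omega hnu mu IH f u v ->
  hnu * nrm (grad (u - v)) ^+ 2 + mu * nrm (IH (u - v)) ^+ 2 =
  (hnu - nu) * inner (grad u) (grad (u - v)) - b (u - v) u (u - v).
Proof.
move=> hIH [Vu hu] [Vv hv]; have Ve := VB Vu Vv.
have [[Xu _] [Xv _] [Xe _]] := And3 Vu Vv Ve.
(* The convective terms combine as b(u,u,e) - b(v,v,e) = b(e,u,e) + b(v,e,e). *)
have subtract (g1 g2 G i i' F b1 b2 b3 b4 b5 : R) :
    nu * g1 + b1 = F -> hnu * g2 + b2 + mu * i' = F -> i' = - i ->
    G = g1 - g2 -> b4 = b1 - b3 -> b5 = b3 - b2 -> b5 = 0 ->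
    hnu * G + mu * i = (hnu - nu) * g1 - b4.
  by move=> E1 E2 Ei -> -> E3 E4; rewrite Ei in E2; lra.
rewrite !nrm_sqr.
exact: (subtract _ _ _ _ _ _ _ _ _ _ _ (hu _ Ve) (hv _ Ve)
  (interpolation_inner_opp hIH Xu Xv Xe) (inner_gradB Xu Xv Xe)
  (bBl mO hb Xu Xv Xu Xe) (bBm mO hb Xv Xu Xv Xe) (b_skew_eq0 mO hb hM Vv Xe)).
Qed.

End solutions.

(** * Error of the assimilated velocity *)

Theorem theorem3p2 (R : realType) (d : nat) (Omega : set 'rV[R]_d)
    (hd : d = 2%N \/ d = 3%N) (hOmega : NSE_domain Omega)
    (CP M : R) (hCP : poincare_constant Omega CP)
    (hb : b_defined Omega) (hM : b_constant Omega M)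
    (f : ('rV[R]_d -> 'rV[R]_d) -> R) (hf : dual Omega f)
    (nu hnu mu H CI : R) (hnu0 : 0 < nu) (hhnu0 : 0 < hnu) (hmu0 : 0 < mu)
    (hH0 : 0 < H) (hCI0 : 0 < CI)
    (IH : ('rV[R]_d -> 'rV[R]_d) -> ('rV[R]_d -> 'rV[R]_d))
    (hIH : interpolation Omega IH H CI)
    (hstab : let lambda := Num.min mu (hnu / (2 * CI ^+ 2 * H ^+ 2)) in
      forall phi, X Omega phi ->
        hnu / 2 * nrm Omega (grad Omega phi) ^+ 2 +
          lambda * nrm Omega phi ^+ 2 <=
        hnu * nrm Omega (grad Omega phi) ^+ 2 +
          mu * nrm Omega (IH phi) ^+ 2)
    (u v : 'rV[R]_d -> 'rV[R]_d)
    (hu : NSE_weak_solution Omega nu f u)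
    (hv : CDA_solution Omega hnu mu IH f u v) :
  let nf := dual_norm Omega f in
  let Cv := Num.sqrt (hnu ^- 2 + mu * CP ^+ 2 * CI ^+ 2 * nu ^- 2 * hnu^-1)
            * nf in
  let alpha0 := M * nu ^- 2 * nf in
  (* the first and third conditions are multiplied out by their denominators,
     which vanish when f = 0 *)
  H * (Num.sqrt 27 * CI * M ^+ 2 * Cv ^+ 2) <= Num.sqrt 2 * hnu ^+ 2 ->
  hnu / (2 * CI ^+ 2 * H ^+ 2) <= mu ->
  H * (46 * CI * nu `^ (3 / 2) * hnu `^ (- (3 / 2)) * alpha0 ^+ 2) < 1 ->
  (nrm Omega (grad Omega u) != 0 ->
     nrm Omega (grad Omega (u - v)) / nrm Omega (grad Omega u) <=
     2 * Num.sqrt 2 * (`|hnu - nu| / hnu)) /\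
  nrm Omega (u - v) <=
    Num.sqrt 2 * CI * H * (`|hnu - nu| / (hnu * nu)) * nf.
Proof.
move=> nf Cv alpha0 hcond1 hcond2 hcond3.
have mO : measurable Omega by case: hOmega => oO _ _ _; exact: open_measurable_row.
have [Vu _] := hu; have [Vv _] := hv.
have [[Xu _] [Xe _]] := conj Vu (VB mO Vu Vv).
have [Lgu Lge] := conj (grad_L2 Xu) (grad_L2 Xe).
have gu_le := weak_solution_norm_grad_le mO hb hM hf hu.
have energy := error_energy mO hb hM hIH hu hv.
have ip_le := cauchy_schwarz mO Lgu Lge.
have b_le := norm_b_le_interp mO hb hM Xe Xu Xe.
have stab := hstab _ Xe.
have nf0 : 0 <= nf by exact: dual_norm_ge0.
have S0 : 0 <= mu * CP ^+ 2 * CI ^+ 2 * nu ^- 2 * hnu^-1.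
  by solve_ge0; rewrite invr_ge0; solve_ge0.
have nfCv : nf ^+ 2 <= hnu ^+ 2 * Cv ^+ 2.
  have h2 : 0 <= hnu ^- 2 by rewrite invr_ge0 sqr_ge0.
  rewrite /Cv exprMn sqr_sqrtr ?addr_ge0// mulrA mulrDr divff ?expf_neq0 ?gt_eqF//.
  rewrite mulrDl mul1r lerDl; apply: mulr_ge0; last exact: sqr_ge0.
  by apply: mulr_ge0 => //; exact: sqr_ge0.
have small : 18 * (CI * H * `|M| ^+ 2 * nf ^+ 2) <= nu ^+ 2 * hnu ^+ 2.
  rewrite real_normK ?num_real//.
  exact: (smallness hnu0 hhnu0 hH0 hCI0 nfCv hcond1 hcond3).
have {}stab := energy_bound stab energy ip_le b_le.
rewrite (min_idPr hcond2) in stab.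
have [grad_bound L2_bound] := error_estimate hnu0 hhnu0 hH0 hCI0 (normr_ge0 M)
  nf0 (nrm_ge0 _ _) (nrm_ge0 _ _) (nrm_ge0 _ _) (normr_ge0 _) gu_le small stab.
split; last exact: L2_bound.
move=> gu_neq0; rewrite ler_pdivrMr; last by rewrite lt_def gu_neq0 nrm_ge0.
exact: grad_bound.
Qed.
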